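(* The Steklov spectrum does not determine the number of smooth versus singular boundary components in dimensions greater than two. That is, in dimensions $n>2$ there exist compact $n$-dimensional Riemannian orbifolds with boundary (possibly disconnected) that have the same Steklov spectrum but for which the number of boundary components that are smooth (contain no singular points), respectively the number of boundary components that contain singular points, are different.
   Context: An $n$-dimensional orbifold (with boundary) is a second countable Hausdorff space with an atlas of compatible charts $(\widetilde U,\Gamma_U,\varphi_U)$, where $\widetilde U$ is a connected open subset of $\mathbf R^n$ (of $\{x\in\mathbf R^n: x_n\ge 0\}$ when there is boundary), $\Gamma_U$ is a finite group acting effectively on $\widetilde U$ by diffeomorphisms, and $\varphi_U:\widetilde U\to U$ induces a homeomorphism $\Gamma_U\backslash\widetilde U\to U$. The boundary consists of the points whose lifts lie in $\{x_n=0\}$. Singular points are those with nontrivial isotropy group. Orbifolds here are allowed to have several connected components. Steklov spectrum: the eigenvalues, with multiplicity, of the Dirichlet-to-Neumann operator $u\mapsto\partial_\nu(Hu)$ on $C^\infty(\partial\mathcal O)$, where $Hu$ is the unique harmonic extension of $u$ to $\mathcal O$ and $\partial_\nu$ is the outward normal derivative; for a disjoint union it is the multiset union of the spectra of the components. *)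

(* Defs.v *)
From mathcomp Require Import all_boot all_order all_fingroup all_algebra.
From mathcomp Require Import all_classical all_reals all_analysis.

Set Implicit Arguments.
Unset Strict Implicit.
Unset Printing Implicit Defensive.

Import Order.TTheory GRing.Theory Num.Theory.
Import numFieldNormedType.Exports.

Local Open Scope classical_set_scope.
Local Open Scope ring_scope.

Section HalfSpaceCalculus.
Context {R : realType} {n : nat}.
Local Notation E := 'rV[R]_n.

(* The coordinate x_n.  For n > 0 the sum has exactly one term. *)
Definition last_coord (x : E) : R := \sum_(i < n | i.+1 == n) x 0 i.

Definition halfspace : set E := [set x | 0 <= last_coord x].

Definition relopen (W : set E) : Prop :=
  exists2 V : set E, open V & W = V `&` halfspace.

(* Partial derivatives of functions on a relatively open subset W of the half
   space: the difference quotient is restricted to the increments t that stay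
   in W.  This is the usual partial derivative away from {x_n = 0}, and the
   one-sided one in the direction e_n at the points of {x_n = 0}. *)
Definition diff_quotient (f : E -> R) (i : 'I_n) (x : E) (t : R) : R :=
  t^-1 * (f (x + t *: delta_mx 0 i) - f x).

Definition increments (W : set E) (i : 'I_n) (x : E) : set_system R :=
  within [set t | W (x + t *: delta_mx 0 i)] (0 : R)^'.

Definition pderivable (W : set E) (f : E -> R) (i : 'I_n) (x : E) : Prop :=
  cvg (diff_quotient f i x t @[t --> increments W i x]).

Definition pderiv (W : set E) (f : E -> R) (i : 'I_n) (x : E) : R :=
  lim (diff_quotient f i x t @[t --> increments W i x]).

Fixpoint Ck (k : nat) (W : set E) (f : E -> R) : Prop :=
  {within W, continuous f} /\
  if k is k'.+1 then
    forall i, (forall x, W x -> pderivable W f i x) /\ Ck k' W (pderiv W f i)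
  else True.

(* Smoothness up to the boundary: partial derivatives of all orders exist and
   are continuous on W.  By Seeley's theorem this is the same as extending
   smoothly, near each point of W, to an open subset of R^n. *)
Definition smooth (W : set E) (f : E -> R) : Prop := forall k, Ck k W f.

Definition smooth_map (W : set E) (h : E -> E) : Prop :=
  forall j, smooth W (fun x => h x 0 j).

(* Row-vector convention: the differential of h at x is v |-> v *m J. *)
Definition jacobian_in (W : set E) (h : E -> E) (x : E) : 'M[R]_n :=
  \matrix_(i, j) pderiv W (fun y => h y 0 j) i x.

(* Laplace-Beltrami operator of the metric G, a field of Gram matrices. *)
Definition laplacian (W : set E) (G : E -> 'M[R]_n) (f : E -> R) (x : E) : R :=
  let vol y := Num.sqrt (\det (G y)) in
  (vol x)^-1 *
  \sum_i pderiv W (fun y => vol y * \sum_j invmx (G y) i j * pderiv W f j y) i x.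

(* Outward unit normal to {x_n = 0}: minus the G-gradient of x_n, which points
   into the half space, divided by its G-norm. *)
Definition outward_normal (G : 'M[R]_n) : 'rV[R]_n :=
  let dxn : 'rV[R]_n := \row_i (i.+1 == n)%:R in
  - ((Num.sqrt ((dxn *m invmx G *m dxn^T) 0 0))^-1 *: (dxn *m invmx G)).

Definition normal_deriv (W : set E) (G : E -> 'M[R]_n) (f : E -> R) (x : E) : R :=
  \sum_i outward_normal (G x) 0 i * pderiv W f i x.

End HalfSpaceCalculus.

Arguments halfspace {R n}.

Section Orbifold.
Context (R : realType) (n : nat).
Local Notation E := 'rV[R]_n.

(* All domains lie in the half space: a chart around an interior point is an
   open set that misses {x_n = 0}. *)
Record orb_chart (X : topologicalType) := OrbChart {
  cdom : set E;
  cgroup : finGroupType;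
  cact : cgroup -> E -> E;
  cmap : E -> X;
  cdom_open : relopen cdom;
  cdom_connected : connected cdom;
  cact_stable : forall g x, cdom x -> cdom (cact g x);
  cact1 : forall x, cdom x -> cact 1%g x = x;
  cactM : forall g h x, cdom x -> cact (g * h)%g x = cact g (cact h x);
  cact_smooth : forall g, smooth_map cdom (cact g);
  cact_effective : forall g, (forall x, cdom x -> cact g x = x) -> g = 1%g;
  cmap_fiber : forall x y, cdom x -> cdom y ->
    (cmap x = cmap y <-> exists g, y = cact g x);
  (* cmap is a quotient map from cdom onto an open subset of X; with cmap_fiber,
     it induces a homeomorphism from the orbit space onto that subset. *)
  cmap_quotient : forall B : set X, B `<=` cmap @` cdom ->
    (open B <-> relopen (cdom `&` cmap @^-1` B)) }.

(* h is a diffeomorphism, with inverse k, from an open part W of the domain of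
   c onto an open part W' of the domain of d, lifting the identity of X. *)
Record chart_change (X : topologicalType) (c d : orb_chart X)
    (W W' : set E) (h k : E -> E) : Prop := ChartChange {
  cc_src_open : relopen W;
  cc_tgt_open : relopen W';
  cc_src_sub : W `<=` cdom c;
  cc_tgt_sub : W' `<=` cdom d;
  cc_fun : forall x, W x -> W' (h x);
  cc_inv : forall y, W' y -> W (k y);
  cc_funK : forall x, W x -> k (h x) = x;
  cc_invK : forall y, W' y -> h (k y) = y;
  cc_fun_smooth : smooth_map W h;
  cc_inv_smooth : smooth_map W' k;
  cc_lift : forall x, W x -> cmap d (h x) = cmap c x }.

Record orbifold := Orbifold {
  ospace :> topologicalType;
  oindex : Type;
  ochart : oindex -> orb_chart ospace;
  ohausdorff : hausdorff_space ospace;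
  osecond_countable : @second_countable ospace;
  ocover : forall p : ospace,
    exists a, exists2 x, cdom (ochart a) x & cmap (ochart a) x = p;
  ocompatible : forall a b x y,
    cdom (ochart a) x -> cdom (ochart b) y ->
    cmap (ochart a) x = cmap (ochart b) y ->
    exists W W' h k,
      [/\ chart_change (ochart a) (ochart b) W W' h k, W x & h x = y] }.

(* metric_compatible says that all chart changes are isometries.  It includes
   the invariance of the metric of a chart under the group of that chart, since
   cact g is a chart change from the chart to itself. *)
Record riemannian_orbifold := RiemannianOrbifold {
  rorb :> orbifold;
  metric : oindex rorb -> E -> 'M[R]_n;
  metric_smooth : forall a i j,
    smooth (cdom (ochart a)) (fun x => metric a x i j);
  metric_sym : forall a x, cdom (ochart a) x -> (metric a x)^T = metric a x;
  metric_pos : forall a x (v : 'rV[R]_n), cdom (ochart a) x -> v != 0 ->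
    0 < (v *m metric a x *m v^T) 0 0;
  metric_compatible : forall a b W W' h k,
    chart_change (ochart a) (ochart b) W W' h k -> forall x, W x ->
    metric a x = jacobian_in W h x *m metric b (h x) *m (jacobian_in W h x)^T }.

End Orbifold.

Section Boundary.
Context {R : realType} {n : nat} (O : orbifold R n).

Definition oboundary : set O := [set p | exists a x,
  [/\ cdom (ochart a) x, last_coord x = 0 & cmap (ochart a) x = p]].

Definition osingular : set O := [set p | exists a x,
  [/\ cdom (ochart a) x, cmap (ochart a) x = p &
      exists2 g : cgroup (ochart a), g != 1%g & cact g x = x]].

Definition boundary_components : set (set O) :=
  [set connected_component oboundary p | p in oboundary].

Definition smooth_boundary_components : set (set O) :=
  [set C | boundary_components C /\ C `&` osingular = set0].

Definition singular_boundary_components : set (set O) :=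
  [set C | boundary_components C /\ C `&` osingular !=set0].

(* Without this, harmonic extensions of boundary data are not unique. *)
Definition components_have_boundary : Prop :=
  forall p : O, connected_component [set: O] p `&` oboundary !=set0.

End Boundary.

Arguments oboundary {R n} O _.
Arguments osingular {R n} O _.
Arguments boundary_components {R n} O _.
Arguments smooth_boundary_components {R n} O _.
Arguments singular_boundary_components {R n} O _.

Section Steklov.
Context {R : realType} {n : nat} (O : riemannian_orbifold R n).

Definition olift (f : O -> R) (a : oindex O) : 'rV[R]_n -> R :=
  f \o cmap (ochart a).

Definition osmooth (f : O -> R) : Prop :=
  forall a, smooth (cdom (ochart a)) (olift f a).

Definition oharmonic (f : O -> R) : Prop := forall a x, cdom (ochart a) x ->
  laplacian (cdom (ochart a)) (@metric _ _ O a) (olift f a) x = 0.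

(* The graph of the Dirichlet-to-Neumann operator: f is the harmonic extension
   H u, and w is its outward normal derivative.  As a restriction of the smooth
   function f, u belongs to C^oo of the boundary. *)
Definition dirichlet_to_neumann (u w : set_type (oboundary O) -> R) : Prop :=
  exists f : O -> R,
    [/\ osmooth f, oharmonic f,
        forall p, f (set_val p) = u p &
        forall a x p, cdom (ochart a) x -> last_coord x = 0 ->
          cmap (ochart a) x = set_val p ->
          normal_deriv (cdom (ochart a)) (@metric _ _ O a) (olift f a) x = w p].

(* The multiplicity of sigma, i.e. the dimension of its eigenspace (0 if sigma
   is not an eigenvalue), is at least k. *)
Definition steklov_mult_ge (sigma : R) (k : nat) : Prop :=
  exists u : 'I_k -> set_type (oboundary O) -> R,
    (forall i, dirichlet_to_neumann (u i) (sigma *: u i)) /\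
    (forall a : 'I_k -> R, \sum_i a i *: u i = 0 -> forall i, a i = 0).

End Steklov.

Definition steklov_isospectral (R : realType) (n : nat)
    (O1 O2 : riemannian_orbifold R n) : Prop :=
  forall sigma k, steklov_mult_ge O1 sigma k <-> steklov_mult_ge O2 sigma k.

(* Main.v *)
(* Let G = (Z/2)^2 and let H1, H2, H3 be its subgroups of order two.  The
   permutation representations satisfy
     Q[G] + 2 Q[G/G] = Q[G/H1] + Q[G/H2] + Q[G/H3],
   since both sides contain the trivial character of G three times and the other
   characters once.  Hence, if G acts on M by isometries, the disjoint unions
   M + 2 G\M and H1\M + H2\M + H3\M are Steklov isospectral: the intertwining
   matrices transplant Steklov eigenfunctions, without any need to solve the
   Dirichlet problem.  Take for M the flat cylinder (R/2Z)^(n-1) x [0, 1], with G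
   flipping the signs of the first two coordinates; these are tangent to the
   boundary because n > 2.  Both ends of M are smooth, but every nontrivial
   subgroup of G fixes points on both ends of M, so that the first orbifold has
   2 smooth and 4 singular boundary components, the second one 0 and 6. *)

Require Import Defs.
From HB Require Import structures.
From mathcomp Require Import all_boot all_order all_fingroup all_algebra.
From mathcomp Require Import all_classical all_reals all_analysis.
From mathcomp Require Import ring lra.

Set Implicit Arguments.
Unset Strict Implicit.
Unset Printing Implicit Defensive.

Import Order.TTheory GRing.Theory Num.Theory.
Import numFieldNormedType.Exports.

Local Open Scope classical_set_scope.
Local Open Scope ring_scope.

(** * Partial derivatives on relatively open subsets of the half space *)

(** The difficulty lies in the atlas. To keep every chart map affine, each quotient of M is realized
    as a quotient of R^n by the group generated by the translations by even integer vectors, the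
    sign changes from a subgroup of G, and the reflection in the last coordinate; the last of these
    makes [0, 1] a quotient of R. Up to translations, group actions, transition maps and
    transplantations are then built from diagonal matrices of signs, so the only chain rule needed
    is the one for such matrices. The metric condition concerns arbitrary smooth lifts of the
    identity, not just chosen transition maps; it follows from the discreteness of the group.
    Transplantation acts on the values of a function along a finite orbit, which reduces
    isospectrality to two mutually inverse matrices acting on invariant functions on G. *)

Section Calculus.
Context {R : realType} {n : nat}.
Local Notation E := 'rV[R]_n.
Implicit Types (W : set E) (f g : E -> R) (x : E) (i : 'I_n).

Lemma row_continuous (T : topologicalType) (h : T -> E) (x : T) :
  (forall j, {for x, continuous (fun y => h y 0 j)}) -> {for x, continuous h}.
Proof.
move=> hc A [P Px sPA];
  apply: (@filterS _ _ _ [set y | forall j, P 0 j (h y 0 j)]).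
  by move=> y Py; apply: sPA => k j; rewrite ord1.
apply: filter_forall => j; exact: (hc j _ (Px 0 j)).
Qed.

Lemma coord_add_delta x i t j :
  (x + t *: delta_mx 0 i) 0 j = x 0 j + t * (j == i)%:R.
Proof. by rewrite !mxE eqxx. Qed.

Lemma affine_continuous (T : topologicalType) (h : T -> R) (a b : R) (x : T) :
  {for x, continuous h} -> {for x, continuous (fun y => a * h y + b)}.
Proof.
move=> hc; apply: cvgD; last exact: cvg_cst.
by apply: cvgM; [exact: cvg_cst | exact: hc].
Qed.

Lemma line_continuous x i : continuous (fun t : R => x + t *: delta_mx 0 i).
Proof.
move=> t; apply: row_continuous => j.
rewrite (_ : (fun _ => _) = (fun s => x 0 j + s * (j == i)%:R)); last first.
  by apply/funext => s; rewrite coord_add_delta.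
by apply: cvgD; [exact: cvg_cst | apply: cvgM;
  [exact: cvg_id | exact: cvg_cst]].
Qed.

(** A positive increment does not lower x_n, so it stays in the half space. Hence the filter of
    admissible increments is proper and partial derivatives are unique, also at boundary points. *)
Lemma increments_at_right W i x : relopen W -> W x ->
  0^'+ `=>` increments W i x.
Proof.
move=> [V oV ->] [Vx Hx] A WA.
have lV : \forall t \near (0:R), V (x + t *: delta_mx 0 i).
  apply: line_continuous; rewrite scale0r addr0; exact: open_nbhs_nbhs.
have {}WA : \forall t \near (0:R), t != 0 ->
    (V `&` halfspace) (x + t *: delta_mx 0 i) -> A t by exact: WA.
apply: filterS2 WA lV => t WA Vt t0; apply: WA; first by rewrite gt_eqF.
split=> //; rewrite /halfspace /last_coord /=.
under eq_bigr do rewrite coord_add_delta.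
rewrite big_split /= addr_ge0 // sumr_ge0 // => j _.
by rewrite mulr_ge0 // ltW.
Qed.

Lemma increments_proper W i x : relopen W -> W x ->
  ProperFilter (increments W i x).
Proof.
move=> oW Wx; apply: Build_ProperFilter_ex.
by move=> A /(increments_at_right oW Wx); exact: filter_ex.
Qed.

Definition is_pderiv W f i x l :=
  diff_quotient f i x t @[t --> increments W i x] --> (l : R).

Lemma pderivableP W f i x :
  pderivable W f i x -> is_pderiv W f i x (pderiv W f i x).
Proof. by []. Qed.

Lemma is_pderiv_pderivable W f i x l :
  is_pderiv W f i x l -> pderivable W f i x.
Proof. by move=> h; apply/cvg_ex; exists l. Qed.

Lemma is_pderivE W f i x l : relopen W -> W x ->
  is_pderiv W f i x l -> pderiv W f i x = l.
Proof.
move=> oW Wx h; have := increments_proper i oW Wx => ?; exact: cvg_lim h.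
Qed.

Lemma increments_near W i x : \forall t \near increments W i x,
  t != 0 /\ W (x + t *: delta_mx 0 i).
Proof.
rewrite /increments /within /=.
suff : \forall t \near (0:R), t != 0 -> W (x + t *: delta_mx 0 i) ->
  t != 0 /\ W (x + t *: delta_mx 0 i) by [].
by apply: filterE => t t0 Wt; split.
Qed.

Lemma is_pderiv_ext W f g i x l : (forall y, W y -> f y = g y) -> W x ->
  is_pderiv W f i x l -> is_pderiv W g i x l.
Proof.
move=> fg Wx; apply: cvg_trans; apply: near_eq_cvg.
apply: filterS (increments_near W i x) => t [_ Wt].
by rewrite /diff_quotient !fg.
Qed.

Lemma pderiv_ext W f g i x : relopen W -> (forall y, W y -> f y = g y) ->
  W x -> pderivable W f i x -> pderiv W g i x = pderiv W f i x.
Proof.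
by move=> oW fg Wx /pderivableP /(is_pderiv_ext fg Wx) /(is_pderivE oW Wx).
Qed.

Lemma Ck_ext k W f g : relopen W -> (forall y, W y -> f y = g y) ->
  Ck k W f -> Ck k W g.
Proof.
move=> oW; elim: k f g => [|k IHk] f g fg /= [cf Df]; split=> //.
- by apply: subspace_eq_continuous cf => y /[!inE] /fg.
- by apply: subspace_eq_continuous cf => y /[!inE] /fg.
move=> i; have [pf Ckf] := Df i; split=> [x Wx|].
  exact: (is_pderiv_pderivable (is_pderiv_ext fg Wx (pderivableP (pf x Wx)))).
by apply: IHk Ckf => y Wy; rewrite (pderiv_ext oW fg Wy (pf y Wy)).
Qed.

Lemma is_pderiv_lin W f g i x a lf lg : is_pderiv W f i x lf ->
  is_pderiv W g i x lg ->
  is_pderiv W (fun y => a * f y + g y) i x (a * lf + lg).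
Proof.
move=> hf hg; rewrite /is_pderiv.
have -> : diff_quotient (fun y => a * f y + g y) i x =
    (fun t => a * diff_quotient f i x t + diff_quotient g i x t).
  by apply/funext => t; rewrite /diff_quotient; ring.
have ? : Filter (increments W i x) by exact: within_filter.
by apply: cvgD => //; apply: cvgM => //; exact: cvg_cst.
Qed.

Lemma Ck_lin k W f g a : relopen W -> Ck k W f -> Ck k W g ->
  Ck k W (fun x => a * f x + g x).
Proof.
move=> oW; elim: k f g => [|k IHk] f g /= [cf Df] [cg Dg].
  split=> // x; apply: cvgD; [|exact: cg].
  by apply: cvgM; [exact: cvg_cst | exact: cf].
split=> [x|i].
  apply: cvgD; [|exact: cg].
  by apply: cvgM; [exact: cvg_cst | exact: cf].
have [pf Cf] := Df i; have [pg Cg] := Dg i.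
have D x : W x -> is_pderiv W (fun y => a * f y + g y) i x
    (a * pderiv W f i x + pderiv W g i x).
  by move=> Wx; apply: is_pderiv_lin; apply: pderivableP; auto.
split=> [x /D /is_pderiv_pderivable //|].
by apply: Ck_ext (IHk _ _ Cf Cg) => // y Wy;
  rewrite (is_pderivE oW Wy (D y Wy)).
Qed.

Lemma smooth_pderivable W f i x : smooth W f -> W x -> pderivable W f i x.
Proof. by move=> /(_ 1) [_ /(_ i)[+ _]]; apply. Qed.

Lemma smooth_pderiv W f i : smooth W f -> smooth W (pderiv W f i).
Proof. by move=> sf k; have [_ /(_ i)[]] := sf k.+1. Qed.

Lemma smooth_ext W f g : relopen W -> (forall y, W y -> f y = g y) ->
  smooth W f -> smooth W g.
Proof. by move=> oW fg sf k; exact: Ck_ext fg (sf k). Qed.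

Lemma smooth_lin W f g a : relopen W -> smooth W f -> smooth W g ->
  smooth W (fun x => a * f x + g x).
Proof. by move=> oW sf sg k; exact: Ck_lin. Qed.

Lemma is_pderiv_affine W i x a j b :
  is_pderiv W (fun y => a * y 0 j + b) i x (a * (j == i)%:R).
Proof.
apply: (@cvg_trans _ ((fun=> a * (j == i)%:R) @ increments W i x)); last first.
  have ? : Filter (increments W i x) by exact: within_filter.
  exact: cvg_cst.
apply: near_eq_cvg; apply: filterS (increments_near W i x) => t [t0 _].
by rewrite /diff_quotient coord_add_delta; field.
Qed.

Lemma smooth_affine W a j b : relopen W -> smooth W (fun y => a * y 0 j + b).
Proof.
move=> oW k; elim: k a b => [|k IHk] a b /=.
  split=> //; apply: continuous_subspaceT => x.
  exact/affine_continuous/coord_continuous.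
split=> [|i].
  apply: continuous_subspaceT => x.
  exact/affine_continuous/coord_continuous.
split=> [x _|].
  exact: (is_pderiv_pderivable (@is_pderiv_affine W i x a j b)).
apply: Ck_ext (IHk 0 (a * (j == i)%:R)) => // y Wy.
by rewrite (is_pderivE oW Wy (@is_pderiv_affine W i y a j b)) mul0r add0r.
Qed.

Definition flip (s : 'I_n -> R) x : E := \row_j (s j * x 0 j).

Lemma flip_add_continuous s (v : E) : continuous (fun x => flip s x + v).
Proof.
move=> x; apply: row_continuous => j.
rewrite (_ : (fun _ => _) = (fun y : E => s j * y 0 j + v 0 j)).
  exact/affine_continuous/coord_continuous.
by apply/funext => y; rewrite !mxE.
Qed.

Lemma flip_continuous s : continuous (flip s).
Proof.
rewrite (_ : flip s = fun x => flip s x + 0); first exact: flip_add_continuous.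
by apply/funext => x; rewrite addr0.
Qed.

Lemma translate_continuous (v : E) : continuous (fun x : E => x + v).
Proof.
rewrite (_ : (fun _ => _) = fun x => flip (fun=> 1) x + v).
  exact: flip_add_continuous.
by apply/funext => x; apply/rowP => j; rewrite !mxE mul1r.
Qed.

Lemma flip_add_delta s x i t :
  flip s (x + t *: delta_mx 0 i) = flip s x + (s i * t) *: delta_mx 0 i.
Proof.
apply/rowP => j; rewrite [LHS]mxE !coord_add_delta mulrDr mulrA.
by congr (_ + _); [rewrite mxE | case: eqVneq => [->|_]; rewrite ?mulr0].
Qed.

(** * Sign changes of coordinates *)

Section Flip.
Variables (s : 'I_n -> R) (W : set E).
Hypotheses (s1 : forall j, s j * s j = 1) (oW : relopen W)
  (Ws : forall y, W y -> W (flip s y)).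

(** Substituting [s i * t] for [t] turns one difference quotient into the other; stability of [W]
    sends admissible increments at [x] to admissible ones at [flip s x]. *)
Lemma is_pderiv_flip f i x l : is_pderiv W f i (flip s x) l ->
  is_pderiv W (f \o flip s) i x (s i * l).
Proof.
have s0 : s i != 0 by apply/eqP => s0; have := s1 i;
  rewrite s0 mul0r => /eqP; rewrite eq_sym oner_eq0.
move=> hf; rewrite /is_pderiv.
have -> : diff_quotient (f \o flip s) i x =
    (fun t => s i * diff_quotient f i (flip s x) (s i * t)).
  apply/funext => t; rewrite /diff_quotient /= flip_add_delta.
  by rewrite invfM !mulrA divff // mul1r.
have ? : Filter (increments W i x) by exact: within_filter.
apply: cvgM => //; first exact: cvg_cst.
apply: (@cvg_comp _ _ _ ( *%R (s i)) (diff_quotient f i (flip s x)) _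
  (increments W i (flip s x))) => // A WA.
have {}WA : \forall t \near (0:R), t != 0 ->
    W (flip s x + t *: delta_mx 0 i) -> A t by exact: WA.
suff : \forall t \near (0:R), t != 0 -> W (x + t *: delta_mx 0 i) -> A (s i * t) by [].
have sc : s i * t @[t --> (0:R)] --> (0:R).
  by rewrite -[X in _ --> X](mulr0 (s i)); exact: mulrl_continuous.
have {}WA : \forall t \near (0:R), s i * t != 0 ->
  W (flip s x + (s i * t) *: delta_mx 0 i) -> A (s i * t) := sc _ WA.
apply: filterS WA => t + t0 Wt; apply.
  by rewrite mulf_neq0.
by rewrite -flip_add_delta; exact: Ws.
Qed.

Lemma within_continuous_flip f :
  {within W, continuous f} -> {within W, continuous (f \o flip s)}.
Proof.
move=> /subspace_continuousP cf; apply/subspace_continuousP => x Wx.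
apply: (@cvg_comp _ _ _ (flip s) f _ (within W (nbhs (flip s x)))).
  rewrite /within => A /= WA.
  have {}WA : \forall y \near x, W (flip s y) -> A (flip s y) :=
    @flip_continuous s x _ WA.
  by apply: filterS WA => y Ay Wy; apply: Ay; exact: Ws.
exact: cf (Ws Wx).
Qed.

Lemma Ck_flip k f : Ck k W f -> Ck k W (f \o flip s).
Proof.
elim: k f => [|k IHk] f /= [cf Df].
  by split=> //; exact: within_continuous_flip.
split=> [|i]; first exact: within_continuous_flip.
have [pf Cf] := Df i.
have D x : W x -> is_pderiv W (f \o flip s) i x (s i * pderiv W f i (flip s x)).
  by move=> Wx; apply: is_pderiv_flip; apply: pderivableP; auto.
split=> [x /D /is_pderiv_pderivable //|].
have C0 : Ck k W (fun=> 0).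
  by apply: Ck_ext (@smooth_affine W 0 i 0 oW k) => // y _; rewrite mul0r addr0.
apply: Ck_ext (Ck_lin (s i) oW (IHk _ Cf) C0) => // y Wy.
by rewrite (is_pderivE oW Wy (D y Wy)) addr0.
Qed.

Lemma smooth_flip f : smooth W f -> smooth W (f \o flip s).
Proof. by move=> sf k; exact: Ck_flip. Qed.

End Flip.

Section LinearCombination.
Variables (I : finType) (W : set E) (A : I -> R) (s : I -> 'I_n -> R)
  (u : I -> E -> R).
Hypotheses (oW : relopen W) (s1 : forall k j, s k j * s k j = 1)
  (Ws : forall k y, W y -> W (flip (s k) y)) (su : forall k, smooth W (u k)).

Lemma smooth_flip_sum (i0 : 'I_n) :
  smooth W (fun x => \sum_k A k * u k (flip (s k) x)).
Proof.
suff H r : smooth W (fun x => \sum_(k <- r) A k * u k (flip (s k) x)) by [].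
elim: r => [|k r IHr].
  (* The empty sum is the affine function with coefficients 0 in the coordinate [i0]; this is the
     purpose of [i0]. *)
  apply: smooth_ext (smooth_affine 0 i0 0 oW) => // y _.
  by rewrite big_nil mul0r addr0.
have sk := smooth_flip (s1 k) oW (Ws k) (su k).
apply: smooth_ext (smooth_lin (A k) oW sk IHr) => // y _.
by rewrite big_cons.
Qed.

Lemma pderiv_flip_sum i x : W x ->
  pderiv W (fun x => \sum_k A k * u k (flip (s k) x)) i x =
  \sum_k A k * s k i * pderiv W (u k) i (flip (s k) x).
Proof.
move=> Wx; apply: is_pderivE => //.
suff H r : is_pderiv W (fun x => \sum_(k <- r) A k * u k (flip (s k) x)) i x
  (\sum_(k <- r) A k * s k i * pderiv W (u k) i (flip (s k) x)) by exact: H.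
elim: r => [|k r IHr].
  have h := @is_pderiv_affine W i x 0 i 0.
  rewrite big_nil; rewrite mul0r in h; apply: (is_pderiv_ext _ Wx h) => y _.
  by rewrite big_nil mul0r addr0.
have sk := smooth_pderivable (su k) (Ws k Wx) (i := i).
have h := is_pderiv_lin (a := A k)
  (is_pderiv_flip (s1 k) (Ws k) (pderivableP sk)) IHr.
rewrite big_cons -mulrA; apply: (is_pderiv_ext _ Wx h) => y _.
by rewrite big_cons.
Qed.

End LinearCombination.

(** * The flat Laplacian and normal derivative *)

Lemma invmx_scalar1 : invmx (1%:M : 'M[R]_n) = 1%:M.
Proof. by rewrite -[LHS]mul1mx mulmxV ?unitmx1. Qed.

Lemma laplacian_euclidean W f x :
  laplacian W (fun=> 1%:M) f x = \sum_i pderiv W (pderiv W f i) i x.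
Proof.
rewrite /laplacian det1 sqrtr1 invr1 mul1r; apply: eq_bigr => i _.
congr (pderiv W _ i x); apply/funext => y.
rewrite mul1r (bigD1 i) //= big1 ?addr0 => [|j ji].
  by rewrite invmx_scalar1 mxE eqxx mul1r.
by rewrite invmx_scalar1 mxE eq_sym (negbTE ji) mul0r.
Qed.

(** Each second derivative picks up the sign [s k i] twice, so the flat Laplacian commutes with sign
    changes. *)
Lemma laplacian_flip_sum (I : finType) W (A : I -> R) (s : I -> 'I_n -> R)
    (u : I -> E -> R) x :
  relopen W -> (forall k j, s k j * s k j = 1) ->
  (forall k y, W y -> W (flip (s k) y)) -> (forall k, smooth W (u k)) -> W x ->
  laplacian W (fun=> 1%:M) (fun x => \sum_k A k * u k (flip (s k) x)) x =
  \sum_k A k * laplacian W (fun=> 1%:M) (u k) (flip (s k) x).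
Proof.
move=> oW s1 Ws su Wx; rewrite laplacian_euclidean.
under [RHS]eq_bigr do rewrite laplacian_euclidean mulr_sumr.
rewrite exchange_big; apply: eq_bigr => i _.
have sd k : smooth W (pderiv W (u k) i) := smooth_pderiv i (su k).
pose B k := A k * s k i.
have sB := smooth_flip_sum B oW s1 Ws sd i.
(* The formula for the first derivatives holds on [W] only; differentiating it again requires its
   right side to be differentiable. *)
rewrite (pderiv_ext oW _ Wx (smooth_pderivable sB Wx (i := i))); last first.
  by move=> y Wy; rewrite pderiv_flip_sum.
rewrite (@pderiv_flip_sum _ W B s (fun k => pderiv W (u k) i)) //.
by apply: eq_bigr => k _; rewrite /B -(mulrA (A k)) s1 mulr1.
Qed.

Lemma normal_deriv_euclidean W f x :
  normal_deriv W (fun=> 1%:M) f x = - \sum_(i < n | i.+1 == n) pderiv W f i x.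
Proof.
rewrite /normal_deriv /outward_normal /= invmx_scalar1 !mulmx1.
set d := \row_i _; have [[i0 i0n]|none] := pselect (exists i : 'I_n, i.+1 == n).
  have dd : (d *m d^T) 0 0 = 1.
    rewrite mxE (bigD1 i0) //= big1 ?addr0 => [|j ji]; rewrite !mxE.
      by rewrite i0n mulr1.
    rewrite (_ : j.+1 == n = false) ?mul0r //.
    apply: contraNF ji => jn.
    by rewrite -val_eqE -eqSS /= (eqP i0n) jn.
  rewrite dd sqrtr1 invr1 scale1r -sumrN [RHS]big_mkcond /=.
  by apply: eq_bigr => i _; rewrite !mxE; case: eqP => _;
    rewrite ?mulN1r ?oppr0 ?mul0r.
rewrite !big1 ?oppr0 // => i; last first.
  by move=> _; rewrite !mxE; case: eqP => [/eqP in'|_]; [case: none;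
    exists i | rewrite mulr0 oppr0 mul0r].
by move=> in'; case: none; exists i.
Qed.

(** The normal involves only the last coordinate, on which all signs are 1. *)
Lemma normal_deriv_flip_sum (I : finType) W (A : I -> R) (s : I -> 'I_n -> R)
    (u : I -> E -> R) x :
  relopen W -> (forall k j, s k j * s k j = 1) ->
  (forall k y, W y -> W (flip (s k) y)) -> (forall k, smooth W (u k)) ->
  (forall k (j : 'I_n), j.+1 = n -> s k j = 1) -> W x ->
  normal_deriv W (fun=> 1%:M) (fun x => \sum_k A k * u k (flip (s k) x)) x =
  \sum_k A k * normal_deriv W (fun=> 1%:M) (u k) (flip (s k) x).
Proof.
move=> oW s1 Ws su sn Wx; rewrite normal_deriv_euclidean.
under [RHS]eq_bigr do rewrite normal_deriv_euclidean mulrN mulr_sumr.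
rewrite sumrN exchange_big; congr (- _); apply: eq_bigr => i /eqP i_n.
rewrite pderiv_flip_sum //; apply: eq_bigr => k _.
by rewrite sn // mulr1.
Qed.

(** Discreteness of the coset a + Z, in the form that turns approximate equalities into exact
    ones. *)
Lemma int_gap (a : R) : exists2 d : R, 0 < d &
  forall m : int, `|a + m%:~R| < d -> a + m%:~R = 0.
Proof.
pose r := a - (Num.floor a)%:~R.
have r0 : 0 <= r by rewrite subr_ge0 floor_le_tmp.
have r1 : r < 1 by rewrite ltrBlDl -intrD1 floorD1_gt.
have E m : a + m%:~R = r + (Num.floor a + m)%:~R by rewrite /r intrD; ring.
(* The points of the coset nearest to 0 are [r] and [r - 1]; if [r = 0], the nearest nonzero ones
   are 1 and -1. *)
exists (if r == 0 then 1 else Num.min r (1 - r)).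
  case: eqP => // /eqP rn0; rewrite lt_min [0 < 1 - r]subr_gt0 r1 andbT.
  by rewrite lt_neqAle eq_sym rn0.
move=> m; rewrite E; move: (_ + m) => k.
case: eqP => [->|_].
  by rewrite add0r -intr_norm ltrz1 ltNge -gtz0_ge1 normr_gt0 negbK => /eqP ->.
rewrite lt_min ltr_norml => /andP[/andP[_ kr]].
rewrite ltr_norml => /andP[kr' _].
have [k0|k0] := lerP 0 k.
  have : 0 <= k%:~R :> R by rewrite ler0z.
  by move: (k%:~R) kr kr' => z; lra.
have : k%:~R <= -1 :> R by rewrite (_ : -1 = (-1)%:~R) // ler_int -ltzD1.
by move: (k%:~R) kr kr' => z; lra.
Qed.

(* The increment f (x + t e_i) - f x differs from +-t (j == i) by an integer or
   an integer plus +-2 x_j; this difference tends to 0, so it is eventually 0. *)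
Lemma pderiv_discrete W (f : E -> R) i j x : relopen W -> W x ->
  pderivable W f i x ->
  (forall y, W y -> exists e (m : int), [\/ e = 1 | e = -1] /\
    f y = e * y 0 j + m%:~R) ->
  pderiv W f i x ^+ 2 = (j == i)%:R.
Proof.
move=> oW Wx /pderivableP; set l := pderiv _ _ _ _ => hl hf.
have FF := increments_proper i oW Wx.
(* Two signs differ by 0, 2 or -2, so three cosets of Z occur. *)
have [d0 d00 D0] := int_gap 0.
have [d1 d10 D1] := int_gap (2 * x 0 j).
have [d2 d20 D2] := int_gap (- (2 * x 0 j)).
pose d := Num.min d0 (Num.min d1 d2).
have dpos : 0 < d by rewrite !lt_min d00 d10 d20.
have [e0 [m0 [e01 fx]]] := hf x Wx.
have t0 : t @[t --> increments W i x] --> (0:R).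
  move=> A A0; rewrite /increments /within /=.
  suff : \forall t \near (0:R), t != 0 -> W (x + t *: delta_mx 0 i) -> A t by [].
  by apply: filterS A0.
have tq : t * diff_quotient f i x t @[t --> increments W i x] --> (0:R).
  by rewrite -[X in _ --> X](mul0r l); apply: cvgM.
have q2 : (diff_quotient f i x t) ^+ 2 @[t --> increments W i x] --> l ^+ 2.
  by rewrite expr2; under eq_fun do rewrite expr2; apply: cvgM.
(* The sign [e] may vary with [t], so a priori only the square of the quotient is eventually
   constant. *)
have qc : (diff_quotient f i x t) ^+ 2 @[t --> increments W i x] -->
    ((j == i)%:R : R).
  apply: (@cvg_trans _ ((fun=> (j == i)%:R) @ increments W i x));
    last exact: cvg_cst.
  apply: near_eq_cvg.
  have /cvgrPdist_lt /(_ (d / 2)) near1 := t0.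
  have /cvgrPdist_lt /(_ (d / 2)) near2 := tq.
  have d2p : 0 < d / 2 by rewrite divr_gt0.
  near=> t.
  have [tn0 Wt] : t != 0 /\ W (x + t *: delta_mx 0 i).
    by near: t; exact: increments_near.
  have tl : `|0 - t| < d / 2 by near: t; exact: near1.
  have ql : `|0 - t * diff_quotient f i x t| < d / 2 by near: t; exact: near2.
  have [e [m [e1 ft]]] := hf _ Wt.
  have E : t * diff_quotient f i x t = f (x + t *: delta_mx 0 i) - f x.
    by rewrite /diff_quotient mulrA divff ?mul1r.
  pose b : R := (j == i)%:R.
  pose B := f (x + t *: delta_mx 0 i) - f x - e * t * b.
  have b01 : b = 0 \/ b = 1 by rewrite /b; case: eqP; [right|left].
  have Bd : `|B| < d.
    rewrite /B -E; move: tl ql; rewrite !sub0r !normrN => tl ql.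
    rewrite (splitr d); apply: le_lt_trans (ler_normB _ _) _.
    apply: ltrD => //; apply: le_lt_trans tl.
    rewrite !normrM; case: e1 => ->; rewrite ?normrN normr1 mul1r.
      by case: b01 => ->; rewrite ?normr0 ?mulr0 ?normr1 ?mulr1.
    by case: b01 => ->; rewrite ?normr0 ?mulr0 ?normr1 ?mulr1.
  have B0 : B = 0.
    have EB : B = (e - e0) * x 0 j + (m - m0)%:~R.
      by rewrite /B ft fx coord_add_delta intrB -/b; ring.
    move: Bd; rewrite EB !lt_min => /and3P[].
    case: e1 => ->; case: e01 => ->.
    - by rewrite subrr mul0r => + _ _; exact: D0.
    - by rewrite (_ : 1 - -1 = 2); [move=> _ + _; exact: D1|ring].
    - by rewrite (_ : -1 - 1 = -2) ?mulNr; [move=> _ _; exact: D2|ring].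
    - by rewrite subrr mul0r => + _ _; exact: D0.
  have -> : diff_quotient f i x t = e * b.
    apply: (mulfI tn0); rewrite E; move: B0; rewrite /B => /eqP.
    by rewrite subr_eq0 => /eqP ->; ring.
  by rewrite -/b; case: e1 => ->; case: b01 => ->; ring.
exact: (cvg_unique _ q2 qc).
Unshelve. all: by end_near. Qed.

End Calculus.

(** * The Klein four-group acting by signs *)

Definition klein : Type := (bool * bool)%type.
HB.instance Definition _ := Finite.copy klein (bool * bool)%type.

Definition klein_mul (s t : klein) : klein := (s.1 (+) t.1, s.2 (+) t.2).
Fact klein_mulA : associative klein_mul.
Proof. by do 3![case=> [[] []]]. Qed.
Fact klein_mul1 : left_id ((false, false) : klein) klein_mul.
Proof. by case=> [[] []]. Qed.
Fact klein_mulV : left_inverse ((false, false) : klein) id klein_mul.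
Proof. by case=> [[] []]. Qed.
HB.instance Definition _ :=
  Finite_isGroup.Build klein klein_mulA klein_mul1 klein_mulV.

Lemma kleinM (s t : klein) : (s * t)%g = (s.1 (+) t.1, s.2 (+) t.2).
Proof. by []. Qed.

Lemma kleinV (s : klein) : (s^-1)%g = s. Proof. by []. Qed.

(** * Congruence modulo 2 in R *)

Section EvenInt.
Context {R : realType}.
Implicit Types a b d : R.

Definition even_int a := exists k : int, a = 2 * k%:~R.

Lemma even_int0 : even_int 0. Proof. by exists 0; rewrite mulr0. Qed.

Lemma even_intD a b : even_int a -> even_int b -> even_int (a + b).
Proof. by move=> [k ->] [l ->]; exists (k + l); rewrite intrD mulrDr. Qed.

Lemma even_intN a : even_int a -> even_int (- a).
Proof. by move=> [k ->]; exists (- k); rewrite mulrNz mulrN. Qed.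

Lemma even_int_double (k : int) : even_int (k%:~R + k%:~R).
Proof. by exists k; ring. Qed.

(** This turns congruences modulo 2 into equalities for coordinates of absolute value less than
    1. *)
Lemma even_int_small a : even_int a -> `|a| < 2 -> a = 0.
Proof.
move=> [k ->]; rewrite normrM -intr_norm ger0_norm // gtr_pMr // ltrz1.
by rewrite ltNge -gtz0_ge1 normr_gt0 negbK => /eqP ->; rewrite mulr0.
Qed.

(** A number outside 2Z has positive distance to 2Z; the bound is uniform in [b], as the Hausdorff
    property requires. *)
Lemma even_int_near a : \forall d \near (0:R)^'+,
  forall b, even_int b -> `|a + b| < d -> even_int a.
Proof.
have [g g0 H] := int_gap (a / 2).
near=> d => b [k bE] ab.
exists (- k); rewrite mulrNz.
suff : a / 2 + k%:~R = 0 by lra.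
apply: H; rewrite -(ltr_pM2l (ltr0Sn R 1)) -{1}[2](@ger0_norm R) // -normrM.
rewrite mulrDr mulrCA divff ?mulr1 // -bE; apply: (lt_le_trans ab).
by near: d; apply: nbhs_right_le; rewrite mulr_gt0.
Unshelve. all: by end_near. Qed.

End EvenInt.

Section Sign.
Context {R : realType} {n : nat}.
Implicit Types (s t : klein) (c d : bool) (j : 'I_n).

(* The element (s, c) flips the coordinates 0 and 1 according to s, and the
   last coordinate according to c. *)
Definition sg s c j : R :=
  (-1) ^+ (if j == 0%N :> nat then s.1 else if j == 1%N :> nat then s.2
           else (j.+1 == n) && c).

Lemma sg_sq s c j : sg s c j * sg s c j = 1.
Proof. by rewrite -expr2 sqrr_sign. Qed.

Lemma sgM s t c d j : sg (s * t)%g (c (+) d) j = sg s c j * sg t d j.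
Proof.
rewrite /sg -signr_addb; congr (_ ^+ nat_of_bool _).
by case: ifP => // _; case: ifP => // _; case: eqP.
Qed.

Lemma sg1 j : sg 1%g false j = 1.
Proof. by rewrite /sg andbF !if_same. Qed.

Lemma sg_or s c j : sg s c j = 1 \/ sg s c j = -1.
Proof. by rewrite /sg; case: ifP => _; [|case: ifP => _];
  case: (X in (-1) ^+ nat_of_bool X); rewrite ?expr1 ?expr0; auto. Qed.

Lemma norm_sg s c j : `|sg s c j| = 1.
Proof. by rewrite normr_sign. Qed.

Lemma even_int_sg s c j a : even_int a -> even_int (sg s c j * a).
Proof.
by case: (sg_or s c j) => ->; rewrite ?mul1r ?mulN1r //; exact: even_intN.
Qed.

(** Sign changes fix 0 and 1 modulo 2, and therefore act in the charts centered at points of {0,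
    1}^n. *)
Lemma even_int_subsg s c j (b : bool) : even_int (b%:R - sg s c j * b%:R).
Proof.
case: (sg_or s c j) => ->; rewrite ?mul1r ?subrr; first exact: even_int0.
by exists b%:Z; ring.
Qed.

End Sign.

(** * The quotient space *)

Local Open Scope quotient_scope.

Section Cube.
Context {R : realType} {n : nat}.
Local Notation E := 'rV[R]_n.

Definition cube (x : E) (r : R) : set E :=
  [set z | forall j, `|z 0 j - x 0 j| < r].

Lemma open_forall_coord (P : 'I_n -> set R) :
  (forall j, open (P j)) -> open [set z : E | forall j, P j (z 0 j)].
Proof.
move=> oP; rewrite openE => z Pz.
exists (fun _ j => P j) => [i j|y Py j]; last exact: Py.
by rewrite ord1; apply: open_nbhs_nbhs; split.
Qed.

Lemma open_cube x r : open (cube x r).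
Proof.
apply: (@open_forall_coord (fun j => [set a | `|a - x 0 j| < r])) => j.
rewrite (_ : [set _ | _] = ball (x 0 j) r); first exact: ball_open.
by apply/seteqP; split => a; rewrite /ball /= distrC.
Qed.

Lemma cube_center x r : 0 < r -> cube x r x.
Proof. by move=> r0 j; rewrite subrr normr0. Qed.

Lemma nbhs_cube (x : E) (A : set E) : nbhs x A ->
  \forall r \near (0:R)^'+, cube x r `<=` A.
Proof.
move=> [P Px PA].
have near1 j : \forall r \near (0:R)^'+,
    forall a, `|a - x 0 j| < r -> P 0 j a.
  have /nbhs_ballP[e /= e0 eP] := Px 0 j.
  near=> r => a ar; apply: eP; rewrite /ball /= distrC; apply: (lt_le_trans ar).
  by near: r; exact: nbhs_right_le.
have near2 : \forall r \near (0:R)^'+, forall j a, `|a - x 0 j| < r -> P 0 j a.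
  exact: filter_forall.
apply: filterS near2 => r rP z zr; apply: PA => i j.
by rewrite ord1; apply: rP; exact: zr.
Unshelve. all: by end_near. Qed.

End Cube.

Section Tile.
Context {R : realType} {n : nat} {I : finType} (K : I -> {group klein}).
Local Notation E := 'rV[R]_n.

Definition sheet_eqv_prop (p q : I * E) : Prop := p.1 = q.1 /\
  exists s c, s \in K p.1 /\ forall j, even_int (q.2 0 j - sg s c j * p.2 0 j).

Definition sheet_eqv : rel (I * E) := fun p q => `[< sheet_eqv_prop p q >].

Fact sheet_eqv_equiv : equiv_class_of sheet_eqv.
Proof.
split.
- move=> p; apply/asboolP; split=> //; exists 1%g, false; split=> [|j].
    exact: group1.
  by rewrite sg1 mul1r subrr; exact: even_int0.
- suff H p q : sheet_eqv_prop p q -> sheet_eqv_prop q p.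
    by move=> p q; apply/asboolP/asboolP; exact: H.
  move=> [pq [s [c [sK e]]]]; split=> //; exists s, c; split=> [|j].
    by rewrite -pq.
  rewrite (_ : _ - _ = - (sg s c j * (q.2 0 j - sg s c j * p.2 0 j))).
    exact/even_intN/even_int_sg.
  by rewrite mulrBr mulrA sg_sq mul1r opprB.
- move=> q p r /asboolP[pq [s [c [sK e]]]] /asboolP[qr [t [d [tK f]]]].
  apply/asboolP; split; first by rewrite pq.
  exists (t * s)%g, (d (+) c); split=> [|j].
    by rewrite groupM // pq.
  rewrite (_ : _ - _ = (r.2 0 j - sg t d j * q.2 0 j) +
      sg t d j * (q.2 0 j - sg s c j * p.2 0 j)).
    by apply: even_intD => //; exact: even_int_sg.
  by rewrite sgM; ring.
Qed.

Canonical sheet_equiv_rel := EquivRelPack sheet_eqv_equiv.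

(* The disjoint union over [i : I] of the products of the quotient of the torus
   R^(n-1)/2Z^(n-1) by [K i] with the interval R/<t -> -t, t -> t + 2>, which is
   homeomorphic to [0, 1]. *)
Definition tile : Type := {eq_quot sheet_eqv}.
HB.instance Definition _ := Choice.on tile.
HB.instance Definition _ := Quotient.on tile.

Definition sheet (i : I) (z : E) : tile := \pi_tile (i, z).

Lemma sheetP i j x y : sheet i x = sheet j y <-> i = j /\
  exists s c, s \in K i /\ forall l, even_int (y 0 l - sg s c l * x 0 l).
Proof. by split=> [/eqmodP/asboolP|h]; last exact/eqmodP/asboolP. Qed.

Lemma sheet_surj (p : tile) : exists i z, p = sheet i z.
Proof.
exists (generic_quotient.repr p).1, (generic_quotient.repr p).2.
by rewrite /sheet -surjective_pairing reprK.
Qed.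

(** The quotient topology, for the product of the discrete space [I] with R^n. *)
Definition tile_open (U : set tile) := forall i, open (sheet i @^-1` U).

Fact tile_openT : tile_open setT.
Proof. by move=> i; exact: openT. Qed.

Fact tile_openI : setI_closed tile_open.
Proof. by move=> A B oA oB i; rewrite preimage_setI; exact: openI. Qed.

Fact tile_open_bigcup (J : Type) (f : J -> set tile) :
  (forall j, tile_open (f j)) -> tile_open (\bigcup_j f j).
Proof.
by move=> oF i; rewrite preimage_bigcup; apply: bigcup_open => j _; exact: oF.
Qed.

HB.instance Definition _ :=
  isOpenTopological.Build tile tile_openT tile_openI tile_open_bigcup.

Lemma openE_tile (U : set tile) : open U = tile_open U. Proof. by []. Qed.

Lemma sheet_continuous i : continuous (sheet i).
Proof. by apply/continuousP => U; rewrite openE_tile. Qed.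

Lemma sheet_openmap i (B : set E) : open B -> open (sheet i @` B).
Proof.
move=> oB; rewrite openE_tile => k; rewrite openE => z [x Bx /sheetP /= [ik]].
subst k => -[s [c [sK e]]].
(* [h] maps [z] to [x] and preserves classes, since its translation part [x - flip (sg s c) z] is
   even. *)
pose h (y : E) := flip (sg s c) y + (x - flip (sg s c) z).
have hz : h z = x by rewrite /h addrC subrK.
have hc : continuous h by exact: flip_add_continuous.
have : nbhs (h z) B by rewrite hz; exact: open_nbhs_nbhs.
move=> /(hc z) hB.
have {}hB : \forall y \near z, B (h y) := hB.
apply: filterS hB => y By; exists (h y) => //.
apply/sheetP; split=> //; exists s, c; split=> // j /=.
rewrite !mxE.
rewrite (_ : _ - _ = - (sg s c j * (x 0 j - sg s c j * z 0 j))).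
  apply/even_intN/even_int_sg.
  rewrite (_ : _ - _ = - (sg s c j * (z 0 j - sg s c j * x 0 j))).
    exact/even_intN/even_int_sg.
  by rewrite mulrBr mulrA sg_sq mul1r opprB.
rewrite mulrDr mulrA sg_sq mul1r; ring.
Qed.

(** If all neighborhoods of two points meet, their coordinates are congruent up to arbitrarily small
    errors. There are only finitely many linear parts [(s, c)], so one error bound makes all these
    congruences exact. *)
Lemma tile_hausdorff : hausdorff_space tile.
Proof.
move=> p q pq.
have [i [x pE]] := sheet_surj p; have [k [y qE]] := sheet_surj q; subst p q.
have near_eq d : 0 < d -> i = k /\ exists sc : klein * bool, sc.1 \in K i /\
    forall j, exists2 b, even_int b & `|(y 0 j - sg sc.1 sc.2 j * x 0 j) + b| < d.
  move=> d0; have d2 : 0 < d / 2 by rewrite divr_gt0.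
  have onb l (w : E) : nbhs (sheet l w) (sheet l @` cube w (d / 2)).
    apply: open_nbhs_nbhs; split; first exact/sheet_openmap/open_cube.
    by exists w => //; exact: cube_center.
  have [r [[x' xx' <-] [y' yy' /sheetP[/= ik [s [c [sK e]]]]]]] := pq _ _ (onb i x) (onb k y).
  split=> //; exists (s, c); split=> [|j] /=; first by rewrite -ik.
  exists (sg s c j * (x' 0 j - sg s c j * y' 0 j)); first exact: even_int_sg.
  rewrite mulrBr mulrA sg_sq mul1r.
  rewrite (_ : _ + _ = sg s c j * (x' 0 j - x 0 j) - (y' 0 j - y 0 j));
    last ring.
  rewrite (splitr d); apply: (le_lt_trans (ler_normB _ _)).
  by rewrite normrM norm_sg mul1r ltrD.
have [ik _] := near_eq 1 ltr01; subst k.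
apply/sheetP; split=> //=.
have : \forall d \near (0:R)^'+, forall sc : klein * bool, forall j b,
    even_int b -> `|(y 0 j - sg sc.1 sc.2 j * x 0 j) + b| < d ->
    even_int (y 0 j - sg sc.1 sc.2 j * x 0 j).
  by apply: filter_forall => sc; apply: filter_forall => j;
    exact: even_int_near.
move=> Hd.
have [d [d0 {}Hd]] : exists d : R, 0 < d /\ forall sc : klein * bool, forall j b,
    even_int b -> `|(y 0 j - sg sc.1 sc.2 j * x 0 j) + b| < d ->
    even_int (y 0 j - sg sc.1 sc.2 j * x 0 j).
  near (0:R)^'+ => d; exists d; split; first by near: d; exact: nbhs_right_gt.
  by near: d; exact: Hd.
have [_ [[s c] /= [sK close]]] := near_eq d d0.
exists s, c; split=> // j; have [b eb bd] := close j.
exact: (Hd (s, c) j b eb bd).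
Unshelve. all: by end_near. Qed.

Lemma tile_second_countable : @second_countable tile.
Proof.
pose B (a : I * {ffun 'I_n -> rat} * nat) : set tile :=
  sheet a.1.1 @` cube (\row_j ratr (a.1.2 j)) (a.2.+1%:R^-1).
exists (range B).
  apply: (@sub_countable _ _ _ [set: I * {ffun 'I_n -> rat} * nat]).
    exact: card_image_le.
  exact: countableP.
split=> [_ [a _ <-]|p A]; first exact/sheet_openmap/open_cube.
have [i [z ->]] := sheet_surj p => /(@sheet_continuous i z) /nbhs_cube zA.
have [r r0 rA] : exists2 r : R, 0 < r & cube z r `<=` sheet i @^-1` A.
  near (0:R)^'+ => r; exists r; first by near: r; exact: nbhs_right_gt.
  by near: r; exact: zA.
have [k kr] : exists k : nat, k.+1%:R^-1 < r / 2.
  have r2 : 0 < r / 2 by rewrite divr_gt0.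
  have := near_infty_natSinv_lt (PosNum r2) => -[k _ /(_ k) /=].
  by move=> /(_ (leqnn k)) ?; exists k.
have qq j : exists q : rat, `|z 0 j - ratr q| < k.+1%:R^-1.
  have k0 : (0 : R) < k.+1%:R^-1 by rewrite invr_gt0.
  move: (k.+1%:R^-1) k0 => e e0.
  have ee : z 0 j - e < z 0 j + e by lra.
  have [q] := rat_in_itvoo ee.
  by rewrite in_itv /= => /andP[q1 q2]; exists q; rewrite ltr_norml; lra.
pose q := [ffun j => sval (cid (qq j))].
exists (B (i, q, k)); first split; first by exists (i, q, k).
  by exists z => //= j; rewrite mxE ffunE; case: cid.
move=> _ [y /= yq <-]; apply: rA => j.
have := yq j; rewrite mxE ffunE; case: cid => /= b zb yb.
rewrite (_ : y 0 j - z 0 j = (y 0 j - ratr b) - (z 0 j - ratr b)); last ring.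
apply: (le_lt_trans (ler_normB _ _)); rewrite (splitr r).
by apply: ltrD; apply: lt_trans kr.
Unshelve. all: by end_near. Qed.

Lemma tile_compact : compact [set: tile].
Proof.
have -> : [set: tile] = \big[setU/set0]_(i <- enum I)
    (sheet i @` [set z : E | forall j, `[0, 2]%classic (z ord0 j)]).
  apply/seteqP; split=> // p _; have [i [z ->]] := sheet_surj p.
  rewrite -bigcup_seq; exists i; first by rewrite /= mem_enum.
  pose f j := Num.floor (z 0 j / 2).
  exists (z - \row_j (2 * (f j)%:~R)).
    move=> j; rewrite /= in_itv /= !mxE.
    have := floor_le_tmp (z 0 j / 2); have := floorD1_gt (z 0 j / 2).
    rewrite intrD -/(f j); move: (f j)%:~R => t; lra.
  apply/sheetP; split=> //; exists 1%g, false; split=> [|j] /=;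
    first exact: group1.
  by exists (f j); rewrite sg1 !mxE; ring.
apply: bigsetU_compact => i _.
apply: continuous_compact; first exact/continuous_subspaceT/sheet_continuous.
exact: (@rV_compact R n (fun=> `[0, 2]%classic) (fun=> @segment_compact R 0 2)).
Qed.

End Tile.

(** * Charts *)

Lemma star_connected {R : realType} {n : nat} (A : set 'rV[R]_n) x0 : A x0 ->
  (forall x t, A x -> 0 <= t <= 1 -> A (x0 + t *: (x - x0))) -> connected A.
Proof.
move=> Ax0 starA.
have -> : A = \bigcup_(x in A) [set x0 + t *: (x - x0) | t in `[0, 1]%classic].
  apply/seteqP; split=> [x Ax|_ [x Ax [t t01 <-]]]; last first.
    by apply: starA => //; move: t01; rewrite /= in_itv.
  exists x => //; exists 1; first by rewrite /= in_itv /= ler01 lexx.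
  by rewrite scale1r addrC subrK.
apply: bigcup_connected.
  exists x0 => x Ax; exists 0; first by rewrite /= in_itv /= ler01 lexx.
  by rewrite scale0r addr0.
move=> x Ax; apply: connected_continuous_connected;
  first exact: segment_connected.
apply: continuous_subspaceT => t; apply: row_continuous => j.
rewrite (_ : (fun _ => _) = (fun y : R => (x - x0) 0 j * y + x0 0 j)).
  by apply: affine_continuous; exact: cvg_id.
by apply/funext => y; rewrite !mxE; ring.
Qed.

Section Charts.
Context {R : realType} {m : nat} {I : finType} (K : I -> {group klein}).
Local Notation n := m.+3.
Local Notation E := 'rV[R]_n.
Local Notation tile := (@tile R n I K).
Implicit Types (x y : E) (c d : 'I_n -> bool).

Lemma last_coordE x : last_coord x = x 0 ord_max.
Proof.
rewrite /last_coord (bigD1 ord_max) //= big1 ?addr0 // => i /andP[/eqP[im]].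
by rewrite -val_eqE /= im eqxx.
Qed.

Definition box : set E := cube 0 1 `&` halfspace.

Lemma boxP x : box x <-> (forall j, `|x 0 j| < 1) /\ 0 <= x 0 ord_max.
Proof.
rewrite /box /cube /halfspace /= last_coordE.
by split=> -[h ->]; split=> // j; have := h j; rewrite mxE subr0.
Qed.

Lemma relopen_box : relopen box.
Proof. by exists (cube 0 1) => //; exact: open_cube. Qed.

Lemma box_connected : connected box.
Proof.
apply: (@star_connected _ _ _ 0) => [|x t].
  by apply/boxP; split=> [j|]; rewrite mxE ?normr0.
move=> /boxP[x1 x0] /andP[t0 t1]; apply/boxP; rewrite subr0 add0r.
split=> [j|]; rewrite mxE; last exact: mulr_ge0.
by rewrite normrM (ger0_norm t0); apply: le_lt_trans (x1 j); rewrite ler_piMl.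
Qed.

(** As the dimension is at least 3, the last index differs from 0 and 1: the Klein group leaves the
    last coordinate alone. *)
Lemma sg_last (s : klein) b : sg s b (ord_max : 'I_n) = (-1) ^+ b :> R.
Proof. by rewrite /sg /= eqxx. Qed.

Lemma sg_notlast (s : klein) b b' (l : 'I_n) : l != ord_max ->
  sg s b l = sg s b' l :> R.
Proof. by rewrite /sg -val_eqE /= eqSS => /negbTE ->. Qed.

Lemma box_flip (s : klein) x : box x -> box (flip (sg s false) x).
Proof.
move=> /boxP[x1 x0]; apply/boxP; split=> [j|]; rewrite mxE.
  by rewrite normrM norm_sg mul1r.
by rewrite sg_last mul1r.
Qed.

Definition lattice_pt c : E := \row_j (c j)%:R.

(* All charts have the same domain, the box, and are centered at the points of
   {0, 1}^n.  Since t -> -t and t -> t + 2 are factored out in the last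
   coordinate, t = 1 + x_n is the same as t = 1 - x_n: the charts with
   c_n = 1 are collars of the end t = 1. *)
Definition chart_map i c x : tile := sheet K i (x + lattice_pt c).

Lemma chart_map_continuous i c : continuous (chart_map i c).
Proof.
move=> x; have hadd := @translate_continuous R n (lattice_pt c) x.
exact: (continuous_comp hadd (@sheet_continuous R n I K i _)).
Qed.

(** Last coordinates lie in [0, 1), where congruence up to sign leaves only [y_n = x_n] for charts
    at the same end and [y_n = 1 - x_n] for charts at opposite ends. The reflection flag [b] is
    normalized so as to depend on the ends alone. *)
Lemma chart_mapP i j c d x y : box x -> box y ->
  chart_map i c x = chart_map j d y -> i = j /\
  exists s b, [/\ s \in K i,
    forall l, even_int (y 0 l + (d l)%:R - sg s b l * (x 0 l + (c l)%:R)) &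
    b = (c ord_max != d ord_max) /\
    y 0 ord_max = if b then 1 - x 0 ord_max else x 0 ord_max].
Proof.
move=> /boxP[x1 x0] /boxP[y1 y0] /sheetP[ij [s [b [sK e]]]]; split=> //.
have {}e l : even_int (y 0 l + (d l)%:R - sg s b l * (x 0 l + (c l)%:R)).
  by have := e l; rewrite !mxE.
have := x1 ord_max; have := y1 ord_max; rewrite !ger0_norm // => yl xl.
have [cd|cd] := eqVneq (c ord_max) (d ord_max).
- have xy : y 0 ord_max = x 0 ord_max.
    have := e ord_max; rewrite -cd sg_last; case: (b) => /= {}e.
      have e0 : y 0 ord_max + x 0 ord_max = 0.
        apply: even_int_small; last by rewrite ger0_norm; lra.
        rewrite (_ : _ + _ = (y 0 ord_max + (c ord_max)%:R -
          (-1) ^+ 1 * (x 0 ord_max + (c ord_max)%:R)) -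
          ((c ord_max)%:~R + (c ord_max)%:~R));
            last by rewrite expr1 -!pmulrn; ring.
        by apply: even_intD => //; exact/even_intN/even_int_double.
      lra.
    apply/eqP; rewrite -subr_eq0; apply/eqP/even_int_small; last first.
      by rewrite ltr_norml; lra.
    by move: e; congr even_int; rewrite expr0; ring.
  exists s, false; split=> // l; have [->|ln] := eqVneq l ord_max.
    by rewrite cd xy sg_last mul1r subrr; exact: even_int0.
  by rewrite (sg_notlast _ _ b ln).
- have cd1 : (d ord_max)%:R = 1 - (c ord_max)%:R :> R.
    by move: cd; case: (c _); case: (d _) => //= _; rewrite ?subrr ?subr0.
  have := e ord_max; rewrite cd1 sg_last; case: b e => /= e el.
    exists s, true; split=> //; split=> //.
    have : y 0 ord_max + x 0 ord_max - 1 = 0.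
      apply: even_int_small; last by rewrite ltr_norml; lra.
      rewrite (_ : _ - _ = (y 0 ord_max + (1 - (c ord_max)%:R) -
        (-1) ^+ 1 * (x 0 ord_max + (c ord_max)%:R)) - (1%:~R + 1%:~R)).
        by apply: even_intD => //; exact/even_intN/even_int_double.
      by rewrite expr1; ring.
    lra.
  (* Without the reflection, [y_n - x_n] would be an odd integer of absolute value less than 1. *)
  exfalso.
  have yx : -1 < y 0 ord_max - x 0 ord_max < 1 by lra.
  have : y 0 ord_max - x 0 ord_max + 1 - 2 * (c ord_max)%:R = 0.
    apply: even_int_small.
      by move: el; congr even_int; rewrite expr0; ring.
    by rewrite ltr_norml; case: (c ord_max) => /=; lra.
  by case: (c ord_max) => /=; lra.
Qed.

Lemma chart_map_flip i c (s : klein) x : s \in K i ->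
  chart_map i c (flip (sg s false) x) = chart_map i c x.
Proof.
move=> sK; apply/esym/sheetP; split=> //; exists s, false; split=> // l.
rewrite !mxE mulrDr opprD addrACA subrr add0r; exact: even_int_subsg.
Qed.

(* The reflection in {x_n = 0} is factored out in the tile, so a neighborhood of
   x in the half space already covers a neighborhood of the image of x. *)
Definition fold_last x : E := \row_j (if j == ord_max then `|x 0 j| else x 0 j).

Lemma fold_last_continuous : continuous fold_last.
Proof.
move=> x; apply: row_continuous => j; case: (eqVneq j ord_max) => [->|jn].
  rewrite (_ : (fun _ => _) = Num.norm \o (fun y : E => y 0 ord_max)).
    by apply: continuous_comp;
      [exact: coord_continuous | exact: norm_continuous].
  by apply/funext => y; rewrite mxE eqxx.
rewrite (_ : (fun _ => _) = (fun y : E => y 0 j));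
  first exact: coord_continuous.
by apply/funext => y; rewrite mxE (negbTE jn).
Qed.

Lemma fold_last_id x : 0 <= x 0 ord_max -> fold_last x = x.
Proof.
move=> x0; apply/rowP => j; rewrite mxE; case: eqP => // ->.
by rewrite ger0_norm.
Qed.

Lemma chart_map_fold_last i c x : chart_map i c (fold_last x) = chart_map i c x.
Proof.
have [x0|x0] := leP 0 (x 0 ord_max); first by rewrite fold_last_id.
apply/esym/sheetP; split=> //; exists 1%g, true; split=> [|l];
  first exact: group1.
rewrite !mxE; case: eqVneq => [->|ln].
  rewrite sg_last ltr0_norm // expr1.
  rewrite (_ : _ - _ = (c ord_max)%:~R + (c ord_max)%:~R).
    exact: even_int_double.
  by rewrite -pmulrn; ring.
rewrite (sg_notlast _ _ false ln) sg1 mul1r subrr; exact: even_int0.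
Qed.

Lemma chart_map_nbhs i c x (B : set tile) :
  nbhs x (chart_map i c @^-1` B) -> nbhs (chart_map i c x) B.
Proof.
move=> xB.
have : nbhs (x + lattice_pt c) (sheet K i @^-1` B).
  have := @translate_continuous R n (- lattice_pt c) (x + lattice_pt c).
  rewrite /continuous_at addrK => /(_ _ xB) h.
  have {}h : \forall y \near x + lattice_pt c,
    B (chart_map i c (y - lattice_pt c)) := h.
  by apply: filterS h => y; rewrite /chart_map subrK.
rewrite nbhsE => -[U [oU Ux] UB]; rewrite nbhsE; exists (sheet K i @` U).
  by split; [exact: sheet_openmap | exists (x + lattice_pt c)].
by move=> _ [y Uy <-]; exact: UB.
Qed.

Lemma chart_map_quotient i c (B : set tile) : B `<=` chart_map i c @` box ->
  (open B <-> relopen (box `&` chart_map i c @^-1` B)).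
Proof.
move=> Bbox; split=> [oB|[V oV VE]].
  exists (cube 0 1 `&` chart_map i c @^-1` B); last by rewrite setIAC.
  apply: openI; first exact: open_cube.
  by have /continuousP h := @chart_map_continuous i c; exact: h.
rewrite openE => p Bp; have [x bx xp] := Bbox p Bp; subst p.
have [Vx Hx] : (V `&` halfspace) x by rewrite -VE.
have x0 : 0 <= x 0 ord_max by rewrite -last_coordE.
apply: chart_map_nbhs.
have : nbhs (fold_last x) V by rewrite fold_last_id //; exact: open_nbhs_nbhs.
move=> /(fold_last_continuous) h.
have {}h : \forall y \near x, V (fold_last y) := h.
apply: filterS h => y Vy.
have [_ By] : (box `&` chart_map i c @^-1` B) (fold_last y).
  by rewrite VE; split=> //; rewrite /halfspace /= last_coordE mxE eqxx.
by rewrite /preimage /= -chart_map_fold_last.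
Qed.

Lemma subg_sgM i (g h : subg_of (K i)) x :
  flip (sg (val (g * h)%g) false) x =
  flip (sg (val g) false) (flip (sg (val h) false) x).
Proof.
apply/rowP => j; rewrite !mxE mulrA.
by rewrite -(sgM _ _ false false).
Qed.

Lemma flip_sg_inj (s t : klein) x : (forall j, x 0 j != 0) ->
  flip (sg s false) x = flip (sg t false) x -> s = t.
Proof.
move=> x0 e.
have {}e (j : 'I_n) : sg s false j = sg t false j :> R.
  by have /rowP/(_ j) := e; rewrite !mxE => /(mulIf (x0 j)).
have := e (inord 0); have := e (inord 1); rewrite /sg !inordK //=.
have inj (a b : bool) : (-1) ^+ a = (-1) ^+ b :> R -> a = b.
  by case: a; case: b => //=; rewrite expr1 expr0 => h; exfalso; lra.
by move=> /inj e2 /inj e1;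
  rewrite (surjective_pairing s) e1 e2 -surjective_pairing.
Qed.

Lemma chart_effective i (g : subg_of (K i)) :
  (forall x, box x -> flip (sg (val g) false) x = x) -> g = 1%g.
Proof.
move=> gx; apply: val_inj; suff : val g = 1%g by [].
pose x : E := const_mx 2^-1.
have xj j : x 0 j = 2^-1 by rewrite mxE.
apply: (@flip_sg_inj _ _ x) => [j|]; first by rewrite xj invr_eq0.
rewrite gx; last first.
  by apply/boxP; split=> [j|]; rewrite xj ?ger0_norm //; lra.
by apply/rowP => j; rewrite [RHS]mxE sg1 mul1r.
Qed.

(** Within a box, congruence modulo 2 is equality, and the center of the chart drops out because
    sign changes fix it modulo 2. *)
Lemma chart_map_fiber i c x y : box x -> box y ->
  (chart_map i c x = chart_map i c y <->
   exists g : subg_of (K i), y = flip (sg (val g) false) x).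
Proof.
move=> bx by_; split=> [e|[g ->]]; last first.
  by rewrite chart_map_flip //; exact: (valP g).
have [_ [s [b [sK el [bE yl]]]]] := chart_mapP bx by_ e.
have b0 : b = false by rewrite bE eqxx.
exists (subg (K i) s); rewrite /= subgK //; subst b.
have /boxP[x1 x0] := bx; have /boxP[y1 y0] := by_.
apply/rowP => l; rewrite mxE; apply/eqP; rewrite -subr_eq0; apply/eqP.
apply: even_int_small; last first.
  apply: (le_lt_trans (ler_normB _ _)); rewrite normrM norm_sg mul1r.
  by have := x1 l; have := y1 l; lra.
rewrite b0 in el *.
rewrite (_ : _ - _ = (y 0 l + (c l)%:R - sg s false l * (x 0 l + (c l)%:R))
  - ((c l)%:R - sg s false l * (c l)%:R)); last ring.
by apply: even_intD => //; exact/even_intN/even_int_subsg.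
Qed.

Fact chart_smooth i (g : subg_of (K i)) :
  smooth_map box (flip (sg (val g) false) : E -> E).
Proof.
move=> j; apply: smooth_ext (@smooth_affine R n box (sg (val g) false j) j 0 relopen_box).
  exact: relopen_box.
by move=> x _; rewrite mxE addr0.
Qed.

Fact chart_act1 i x : box x -> flip (sg (val (1%g : subg_of (K i))) false) x = x.
Proof. by move=> _; apply/rowP => j; rewrite mxE sg1 mul1r. Qed.

Definition tile_chart (a : I * ('I_n -> bool)) : orb_chart R n tile :=
  @OrbChart R n tile box (subg_of (K a.1)) (fun g => flip (sg (val g) false))
    (chart_map a.1 a.2) relopen_box box_connected
    (fun g x => @box_flip (val g) x) (@chart_act1 a.1)
    (fun g h x _ => subg_sgM g h x) (@chart_smooth a.1) (@chart_effective a.1)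
    (@chart_map_fiber a.1 a.2) (@chart_map_quotient a.1 a.2).

End Charts.

(** * The orbifold *)

Section Orbifold.
Context {R : realType} {m : nat} {I : finType} (K : I -> {group klein}).
Local Notation n := m.+3.
Local Notation E := 'rV[R]_n.
Local Notation tile := (@tile R n I K).
Implicit Types (x y : E) (c d : 'I_n -> bool).

Fact tile_cover (p : tile) : exists a : I * ('I_n -> bool),
  exists2 x, cdom (tile_chart K a) x & cmap (tile_chart K a) x = p.
Proof.
have [i [z ->]] := sheet_surj p.
pose f l := Num.floor (z 0 l / 2).
pose r l : R := z 0 l - 2 * (f l)%:~R.
have r0 l : 0 <= r l.
  by have := floor_le_tmp (z 0 l / 2); rewrite -/(f l) /r;
    move: (f l)%:~R => t; lra.
have r2 l : r l < 2.
  have := floorD1_gt (z 0 l / 2); rewrite intrD -/(f l) /r.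
  by move: (f l)%:~R => t; lra.
(* The integer part of the coordinate reduced to [0, 2) selects the center; the remainder is the
   point of the box. *)
pose c l := 1 <= r l.
pose x : E := \row_l (r l - (c l)%:R).
have x01 l : 0 <= x 0 l < 1.
  rewrite mxE /c; have := r0 l; have := r2 l.
  by case: (lerP 1 (r l)) => h r2' r0' /=; apply/andP; split; lra.
exists (i, c); exists x.
  apply/boxP; split=> [l|]; last by have /andP[] := x01 ord_max.
  by have /andP[h0 h1] := x01 l; rewrite ger0_norm.
apply/sheetP; split=> //; exists 1%g, false; split=> [|l]; first exact: group1.
by exists (f l); rewrite sg1 !mxE /r; ring.
Qed.

(** * Transition maps *)

Section Transition.
Variables (i : I) (c d : 'I_n -> bool) (s : klein) (b : bool) (v : E).
Hypotheses (sK : s \in K i)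
  (cd : forall l, even_int (v 0 l + (d l)%:R - sg s b l * (c l)%:R))
  (vn : v 0 ord_max = b%:R).

Let e : 'I_n -> R := sg s b.
Let h x : E := flip e x + v.
Let k x : E := flip e x + - flip e v.

Fact transition_hK : cancel h k.
Proof.
move=> x; apply/rowP => l; rewrite !mxE /e mulrDr mulrA sg_sq; ring.
Qed.

Fact transition_kK : cancel k h.
Proof.
move=> x; apply/rowP => l; rewrite !mxE /e mulrDr mulrN !mulrA sg_sq; ring.
Qed.

Let overlap (g : E -> E) : set E := (cube 0 1 `&` g @^-1` cube 0 1) `&` halfspace.

Let overlap_open g : continuous g -> relopen (overlap g).
Proof.
move=> /continuousP gc; exists (cube 0 1 `&` g @^-1` cube 0 1) => //.
by apply: openI; [exact: open_cube | apply: gc; exact: open_cube].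
Qed.

(** In the last coordinate [h] and [k] are both the identity or both [x_n |-> 1 - x_n], and
    [x_n < 1] in the cube. So imposing the half space on the source of a transition imposes it on
    the target. *)
Let halfspace_swap x : cube 0 1 x -> halfspace x ->
  halfspace (h x) /\ halfspace (k x).
Proof.
rewrite /halfspace /= !last_coordE => /(_ ord_max); rewrite mxE subr0 ltr_norml.
move=> /andP[_ x1] x0; rewrite !mxE vn /e sg_last.
by case: (b) => /=; rewrite ?expr1 ?expr0; lra.
Qed.

Fact tile_chart_change :
  chart_change (tile_chart K (i, c)) (tile_chart K (i, d)) (overlap h) (overlap k) h k.
Proof.
have oh : relopen (overlap h) by apply/overlap_open/flip_add_continuous.
have ok : relopen (overlap k) by apply/overlap_open/flip_add_continuous.
split=> //.
- by move=> x [[]].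
- by move=> x [[]].
- move=> x [[x1 hx1] hx]; split; last by have [] := halfspace_swap x1 hx.
  by split=> //; rewrite /preimage /= transition_hK.
- move=> x [[x1 hx1] hx]; split; last by have [] := halfspace_swap x1 hx.
  by split=> //; rewrite /preimage /= transition_kK.
- by move=> x _; exact: transition_hK.
- by move=> x _; exact: transition_kK.
- move=> l; apply: smooth_ext (@smooth_affine R n _ (e l) l (v 0 l) oh) => // x _.
  by rewrite !mxE.
- move=> l; apply: smooth_ext (@smooth_affine R n _ (e l) l (- flip e v 0 l) ok) => // x _.
  by rewrite !mxE.
- move=> x _; apply/esym/sheetP; split=> //; exists s, b; split=> // l.
  by move: (cd l); congr even_int; rewrite !mxE /e; ring.
Qed.

End Transition.

Fact tile_compatible (a b : I * ('I_n -> bool)) x y :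
  cdom (tile_chart K a) x -> cdom (tile_chart K b) y ->
  cmap (tile_chart K a) x = cmap (tile_chart K b) y ->
  exists W W' h k,
    [/\ chart_change (tile_chart K a) (tile_chart K b) W W' h k, W x & h x = y].
Proof.
case: a b => [i c] [j d] /= bx by_ e.
have [/= ij [s [b [sK el [bE yl]]]]] := chart_mapP bx by_ e; subst j.
pose v := y - flip (sg s b) x.
have hx : flip (sg s b) x + v = y by rewrite /v addrC subrK.
eexists; eexists; eexists; eexists; split.
- apply: (@tile_chart_change i c d s b v sK) => [l|].
    by move: (el l); congr even_int; rewrite !mxE; ring.
  by rewrite !mxE yl sg_last; case: (b) => /=; rewrite ?expr1 ?expr0; ring.
- have [x1 x0] := bx; have [y1 y0] := by_; split=> //; split=> //.
  by rewrite /preimage /= hx.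
- exact: hx.
Qed.

Definition tile_orbifold : orbifold R n :=
  @Orbifold R n tile (I * ('I_n -> bool))%type (tile_chart K)
    (@tile_hausdorff R n I K) (@tile_second_countable R n I K)
    tile_cover tile_compatible.

(** Only the squares of the entries are available, but they force [J] to be diagonal with entries 1
    or -1. *)
Lemma mulmx_jacobian_tr (J : 'M[R]_n) :
  (forall i j, J i j ^+ 2 = (j == i)%:R) -> J *m 1%:M *m J^T = 1%:M.
Proof.
move=> J2; rewrite mulmx1; apply/matrixP => i j; rewrite !mxE.
have J0 k l : l != k -> J k l = 0.
  by move=> lk; apply/eqP; rewrite -sqrf_eq0 J2 (negbTE lk).
rewrite (bigD1 i) //= big1 ?addr0 => [|l li]; last by rewrite J0 ?mul0r.
rewrite mxE; case: eqVneq => [<-|ij]; first by rewrite -expr2 J2 eqxx.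
by rewrite (J0 j) ?mulr0.
Qed.

(** By [chart_mapP], any lift of the identity is in each coordinate a sign times that coordinate
    plus an integer. Sign and integer might jump from point to point, which [pderiv_discrete] allows
    for. *)
Fact tile_metric_compatible (a b : I * ('I_n -> bool)) W W' h k :
  chart_change (tile_chart K a) (tile_chart K b) W W' h k -> forall x, W x ->
  1%:M = jacobian_in W h x *m 1%:M *m (jacobian_in W h x)^T.
Proof.
move=> cc x Wx; apply/esym/mulmx_jacobian_tr => i j; rewrite mxE.
apply: (pderiv_discrete (cc_src_open cc) Wx).
  exact: (smooth_pderivable (cc_fun_smooth cc j) Wx).
move=> y Wy; have bh := cc_tgt_sub cc (cc_fun cc Wy).
have [_ [s [c [_ e _]]]] := chart_mapP (cc_src_sub cc Wy) bh (esym (cc_lift cc Wy)).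
have [l le] := e j.
exists (sg s c j); case: (sg_or (R := R) s c j) => se; rewrite se in le *.
  exists (l + l + (a.2 j)%:Z - (b.2 j)%:Z); split; first by left.
  rewrite !intrD mulrNz -!pmulrn; lra.
exists (l + l - (a.2 j)%:Z - (b.2 j)%:Z); split; first by right.
rewrite !intrD !mulrNz -!pmulrn; lra.
Qed.

(** Transparent, so that the metric unfolds to the identity matrix later on. *)
Definition tile_riemannian : riemannian_orbifold R n.
Proof.
apply: (@RiemannianOrbifold R n tile_orbifold (fun _ _ => 1%:M)).
- move=> a i j; apply: smooth_ext (@smooth_affine R n _ 0 i (1%:M i j) _) => //.
  + exact: relopen_box.
  + by move=> x _; rewrite mul0r add0r.
  + exact: relopen_box.
- by move=> a x _; rewrite trmx1.
- move=> a x v _ v0; rewrite mulmx1 mxE.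
  rewrite lt_neqAle sumr_ge0 ?andbT; last by move=> j _;
    rewrite mxE -expr2 sqr_ge0.
  apply: contra v0; rewrite eq_sym psumr_eq0; last by move=> j _;
    rewrite mxE -expr2 sqr_ge0.
  move=> /allP h; apply/eqP/rowP => j; have := h j (mem_index_enum j).
  by rewrite !mxE /= mulf_eq0 orbb => /eqP.
- exact: tile_metric_compatible.
Defined.

End Orbifold.

(** * Transplantation of Steklov eigenfunctions *)

Section Boundary.
Context {R : realType} {m : nat} {I : finType} (K : I -> {group klein}).
Local Notation n := m.+3.
Local Notation E := 'rV[R]_n.
Local Notation tile := (@tile R n I K).
Implicit Types (x y z : E) (c d : 'I_n -> bool).

Lemma sheet_flip i (s : klein) z : s \in K i ->
  sheet K i (flip (sg s false) z) = sheet K i z.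
Proof.
move=> sK; apply/esym/sheetP; split=> //; exists s, false; split=> // l.
by rewrite mxE subrr; exact: even_int0.
Qed.

(** The last coordinate of [x] is an integer in [0, 1). Thus lying on the boundary does not depend
    on the chart. *)
Lemma chart_last_coord0 i j c x z (t : bool) : box x ->
  chart_map K i c x = sheet K j z -> z 0 ord_max = t%:R -> last_coord x = 0.
Proof.
move=> /boxP[x1 x0] /sheetP[_ [s [b [_ e]]]] zt; rewrite last_coordE.
have [k] := e ord_max; rewrite zt !mxE => h.
have x11 := x1 ord_max; rewrite ger0_norm // in x11.
have [l xl] : exists l : int, x 0 ord_max = l%:~R.
  case: (sg_or (R := R) s b (ord_max : 'I_n)) => se; rewrite se in h.
    exists (t%:Z - (c ord_max)%:Z - k - k).
    rewrite !intrD !mulrNz -!pmulrn; lra.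
  exists (k + k - t%:Z - (c ord_max)%:Z).
  rewrite !intrD !mulrNz -!pmulrn; lra.
move: x0 x11; rewrite xl ler0z ltrz1 => l0 l1.
by have -> : l = 0 by apply/eqP; rewrite eq_le l0 andbT -ltzD1.
Qed.

Lemma oboundaryP (p : tile) : oboundary (tile_orbifold K) p <->
  exists i (t : bool) z, z 0 ord_max = t%:R /\ p = sheet K i z.
Proof.
split=> [[[i c] [x [bx x0 <-]]]|[i [t [z [zt ->]]]]].
  exists i, (c ord_max), (x + lattice_pt c); split=> //.
  by rewrite !mxE -(last_coordE x) x0 add0r.
have [[j c] [x bx xE]] := tile_cover (sheet K i z).
exists (j, c), x; split=> //; exact: (chart_last_coord0 bx xE zt).
Qed.

End Boundary.

Section Transplantation.
Context {R : realType} {m : nat}.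
Local Notation n := m.+3.
Local Notation E := 'rV[R]_n.
Implicit Types (I J : finType).

(** Families of functions on G constant on the cosets of [K i]: the direct sum of the permutation
    representations R[G/K i]. *)
Definition klein_invariant I (K : I -> {group klein}) (v : I -> klein -> R) :=
  forall i s t, t \in K i -> v i (s * t)%g = v i s.

(** Right multiplication commutes with left translations of G, as an intertwining operator must. *)
Definition klein_act I J (A : I -> J * klein -> R) (v : J -> klein -> R) :
    I -> klein -> R :=
  fun i s => \sum_q A i q * v q.1 (s * q.2)%g.

(** The values of [f] along the G-orbit of [z] in the cover, where all of G acts. *)
Definition klein_values I K (f : @tile R n I K -> R) (z : E) :
    I -> klein -> R :=
  fun i s => f (sheet K i (flip (sg s false) z)).

Lemma kleinC (s t : klein) : (s * t = t * s)%g.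
Proof. by rewrite !kleinM addbC [s.2 (+) _]addbC. Qed.

Lemma flipM (s t : klein) (z : E) :
  flip (sg (s * t)%g false) z = flip (sg s false) (flip (sg t false) z).
Proof. by apply/rowP => j; rewrite !mxE mulrA -(sgM _ _ false false). Qed.

Lemma klein_values_invariant I K (f : @tile R n I K -> R) z :
  klein_invariant K (klein_values f z).
Proof.
by move=> i s t tK; rewrite /klein_values kleinC flipM sheet_flip.
Qed.

Section Transplant.
Context {I J : finType} (K : I -> {group klein}) (L : J -> {group klein})
  (A : I -> J * klein -> R).
Hypothesis A_invariant : forall v, klein_invariant L v ->
  klein_invariant K (klein_act A v).
Implicit Type f : @tile R n J L -> R.

Definition transplant f (p : @tile R n I K) : R :=
  let r := generic_quotient.repr p in klein_act A (klein_values f r.2) r.1 1%g.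

(** Independence of the representative: a sign change from [K i] is absorbed by the invariance of
    [klein_act A], while even translations and the reflection commute with G modulo 2 and are
    absorbed by [f]. *)
Lemma transplant_sheet f i z :
  transplant f (sheet K i z) = klein_act A (klein_values f z) i 1%g.
Proof.
rewrite /transplant; set r := generic_quotient.repr _.
have : sheet K i z = sheet K r.1 r.2.
  by rewrite [RHS]/sheet -surjective_pairing reprK.
case: r => [j w] /= /sheetP[<- [s [b [sK e]]]].
rewrite -[RHS](A_invariant (@klein_values_invariant _ _ f z) 1%g sK) mul1g.
apply: eq_bigr => -[k t] _ /=; rewrite mul1g; congr (_ * f _).
apply/esym/sheetP; split=> //; exists 1%g, b; split=> [|l]; first exact: group1.
rewrite kleinC flipM !mxE.
rewrite (_ : _ - _ = sg t false l * (w 0 l - sg s b l * z 0 l)).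
  exact: even_int_sg.
have -> : sg s b l = sg 1%g b l * sg s false l :> R by rewrite -sgM mul1g addbF.
ring.
Qed.

Lemma klein_values_transplant f z :
  klein_values (transplant f) z = klein_act A (klein_values f z).
Proof.
apply/funext => i; apply/funext => s; rewrite {1}/klein_values transplant_sheet.
apply: eq_bigr => -[k t] _ /=; congr (_ * f (sheet _ _ _)).
by rewrite mul1g kleinC flipM.
Qed.

(** Sign changes fix the center of a chart modulo 2, so in charts a transplanted function is a
    linear combination of the kind treated by [laplacian_flip_sum]. *)
Lemma transplant_chart f i c x : transplant f (chart_map K i c x) =
  \sum_q A i q * f (chart_map L q.1 c (flip (sg q.2 false) x)).
Proof.
rewrite /chart_map transplant_sheet; apply: eq_bigr => -[k t] _ /=.
congr (_ * f _); rewrite mul1g; apply/esym/sheetP; split=> //.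
exists 1%g, false; split=> [|l]; first exact: group1.
rewrite !mxE sg1 mul1r.
rewrite (_ : _ - _ = - ((c l)%:R - sg t false l * (c l)%:R)); last ring.
exact/even_intN/even_int_subsg.
Qed.

Lemma transplant_sum (N : nat) (a : 'I_N -> R)
    (F : 'I_N -> @tile R n J L -> R) p :
  transplant (fun p => \sum_i a i * F i p) p = \sum_i a i * transplant (F i) p.
Proof.
have [k [z ->]] := sheet_surj p; rewrite transplant_sheet.
under [RHS]eq_bigr do rewrite transplant_sheet mulr_sumr.
rewrite exchange_big; apply: eq_bigr => q _ /=.
by rewrite mulr_sumr; apply: eq_bigr => i _; rewrite mulrCA.
Qed.

End Transplant.

(** The eigenfunction is represented by its harmonic extension, on which [transplant] acts; only
    linear independence remains to be tested on the boundary. *)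
Definition steklov_fun I (K : I -> {group klein}) (sigma : R)
    (f : tile_riemannian (R := R) (m := m) K -> R) :=
  [/\ osmooth f, oharmonic f &
    forall a x, box x -> last_coord x = 0 ->
      normal_deriv (n := n) box (fun=> 1%:M) (Defs.olift f a) x =
        sigma * Defs.olift f a x].

Lemma steklov_fun_transplant I J (K : I -> {group klein})
    (L : J -> {group klein}) (A : I -> J * klein -> R) sigma f :
  (forall v, klein_invariant L v -> klein_invariant K (klein_act A v)) ->
  steklov_fun (K := L) sigma f ->
  steklov_fun (K := K) sigma (transplant A f).
Proof.
move=> HA [sf hf nf].
have olE a : Defs.olift (O := tile_riemannian K) (transplant A f) a =
    (fun x => \sum_q A a.1 q *
      Defs.olift (O := tile_riemannian L) f (q.1, a.2) (flip (sg q.2 false) x)).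
  by apply/funext => x; exact: transplant_chart.
have obox := @relopen_box R m.
have sq (q : J * klein) (j : 'I_n) : sg q.2 false j * sg q.2 false j = 1 :> R by exact: sg_sq.
have fbox (q : J * klein) (y : E) : box y -> box (flip (sg q.2 false) y) by exact: box_flip.
have su c (q : J * klein) : smooth box (Defs.olift (O := tile_riemannian L) f (q.1, c)).
  exact: (sf (q.1, c)).
split.
- move=> a; rewrite olE.
  exact: (@smooth_flip_sum _ _ _ box (A a.1) (fun q => sg q.2 false) _ obox sq fbox (su a.2) ord0).
- move=> a x bx; rewrite olE.
  rewrite (@laplacian_flip_sum _ _ _ box (A a.1) (fun q => sg q.2 false) _ x obox sq fbox (su a.2)) //.
  apply: big1 => q _; rewrite [X in _ * X](_ : _ = 0) ?mulr0 //.
  exact: (hf (q.1, a.2) _ (fbox q x bx)).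
- move=> a x bx x0; rewrite olE.
  rewrite (@normal_deriv_flip_sum _ _ _ box (A a.1) (fun q => sg q.2 false) _ x obox sq fbox (su a.2)) //.
    rewrite mulr_sumr; apply: eq_bigr => q _.
    rewrite nf; [exact: mulrCA | exact: fbox |].
    by rewrite last_coordE mxE sg_last mul1r -last_coordE.
  by move=> q j [jn]; rewrite (_ : j = ord_max) ?sg_last //; apply: val_inj.
Qed.

Lemma steklov_mult_geP I (K : I -> {group klein}) sigma N :
  steklov_mult_ge (tile_riemannian (R := R) (m := m) K) sigma N <->
  exists F : 'I_N -> @tile R n I K -> R,
    (forall i, steklov_fun (K := K) sigma (F i)) /\
    forall a : 'I_N -> R,
    (forall p, oboundary (tile_orbifold K) p -> \sum_i a i * F i p = 0) ->
    forall i, a i = 0.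
Proof.
split=> [[u [uDN uind]]|[F [FS Find]]].
  have [F FE] := choice uDN; exists F; split=> [i|a aF].
    have [sF hF bF nF] := FE i; split=> // a x bx x0.
    have pb : oboundary (tile_orbifold K) (cmap (tile_chart K a) x) by exists a, x.
    have e := nF a x (SigSub (mem_set pb)) bx x0 erefl.
    rewrite [LHS]e; congr (_ * _); rewrite -bF; congr (F i _).
  apply: uind; apply/funext => p.
  rewrite fct_sumE -[RHS](aF (set_val p)); last exact: (set_mem (valP p)).
  by apply: eq_bigr => i _; have [_ _ bF _] := FE i; rewrite bF.
exists (fun i p => F i (set_val p)); split=> [i|a a0].
  have [sF hF nF] := FS i; exists (F i); split=> // a x p bx x0 px.
  rewrite [LHS]nF //; congr (_ * _).
  exact: (congr1 (F i) px).
apply: Find => p pb.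
have /(congr1 (fun w => w (SigSub (mem_set pb)))) := a0.
by rewrite fct_sumE.
Qed.

(** Linear independence survives because [B] recovers the boundary values of the original functions
    from those of their transplants: the orbit of a boundary point consists of boundary points. *)
Lemma transplant_steklov_mult_ge I J (K : I -> {group klein})
    (L : J -> {group klein}) (A : I -> J * klein -> R) (B : J -> I * klein -> R)
    sigma N :
  (forall v, klein_invariant L v -> klein_invariant K (klein_act A v)) ->
  (forall v, klein_invariant L v -> klein_act B (klein_act A v) = v) ->
  steklov_mult_ge (tile_riemannian (R := R) (m := m) L) sigma N ->
  steklov_mult_ge (tile_riemannian (R := R) (m := m) K) sigma N.
Proof.
move=> HA BA /steklov_mult_geP[F [FS Find]]; apply/steklov_mult_geP.
exists (fun i => transplant A (F i)); split=> [i|a a0].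
  exact: steklov_fun_transplant.
apply: Find => p /oboundaryP[k [t [z [zt ->]]]].
pose f p := \sum_i a i * F i p; rewrite -/(f _).
have -> : f (sheet L k z) = klein_values f z k 1%g.
  congr (f (sheet _ _ _)); apply/rowP => j; rewrite mxE sg1 mul1r //.
rewrite -(BA _ (@klein_values_invariant _ _ f z)).
rewrite -(klein_values_transplant HA) {1}/klein_act big1 // => q _.
rewrite {1}/klein_values (transplant_sum HA) a0 ?mulr0 //.
apply/oboundaryP; exists q.1, t, (flip (sg (1 * q.2)%g false) z).
by rewrite mxE sg_last mul1r.
Qed.

End Transplantation.

(** * Boundary components *)

Section BoundaryComponents.
Context {R : realType} {m : nat} {I : finType} (K : I -> {group klein}).
Local Notation n := m.+3.
Local Notation E := 'rV[R]_n.
Local Notation tile := (@tile R n I K).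
Local Notation O := (@tile_orbifold R m I K).
Implicit Types (w x y z : E) (i : I) (t u : bool).

Definition end_pt t : E := \row_l (if l == ord_max then t%:R else 0).

Definition end_comp (it : I * bool) : set tile :=
  connected_component (oboundary O) (sheet K it.1 (end_pt it.2)).

Lemma end_pt_last t : end_pt t 0 ord_max = t%:R.
Proof. by rewrite mxE eqxx. Qed.

Lemma end_pt_boundary i t : oboundary O (sheet K i (end_pt t)).
Proof. by apply/oboundaryP; exists i, t, (end_pt t); rewrite end_pt_last. Qed.

Lemma end_comp_sheet i t z : z 0 ord_max = t%:R -> end_comp (i, t) (sheet K i z).
Proof.
move=> zt; exists (sheet K i @` [set w : E | w 0 ord_max = t%:R]);
  last by exists z.
split.
- by exists (end_pt t) => //; exact: end_pt_last.
- by move=> _ [w wt <-]; apply/oboundaryP; exists i, t, w.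
apply: connected_continuous_connected; last first.
  exact/continuous_subspaceT/sheet_continuous.
apply: (@star_connected _ _ _ (end_pt t)); first exact: end_pt_last.
move=> w a /= wt _; rewrite !mxE eqxx wt; ring.
Qed.

Lemma tile_connected_component i z z' :
  connected_component [set: tile] (sheet K i z) (sheet K i z').
Proof.
exists (range (sheet K i)); last by exists z'.
split=> //.
apply: connected_continuous_connected; last first.
  exact/continuous_subspaceT/sheet_continuous.
exact: (@star_connected _ _ _ 0).
Qed.

Lemma tile_components_have_boundary : components_have_boundary O.
Proof.
move=> p; have [i [z ->]] := sheet_surj p.
exists (sheet K i (end_pt false)); split; first exact: tile_connected_component.
exact: end_pt_boundary.
Qed.

(** Radius one half keeps out the boundary points of every other end. *)
Definition end_nbhs (it : I * bool) : set tile :=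
  sheet K it.1 @` [set w : E | `|w 0 ord_max - it.2%:R| < 2^-1].

Lemma end_nbhs_open it : open (end_nbhs it).
Proof.
apply: sheet_openmap.
pose P (j : 'I_n) : set R := if j == ord_max then ball (it.2%:R : R) 2^-1 else setT.
rewrite (_ : [set _ | _] = [set w : E | forall j, P j (w 0 j)]).
  by apply: open_forall_coord => j; rewrite /P; case: eqP => _;
    [exact: ball_open|exact: openT].
apply/seteqP; split=> w /=.
  by move=> h j; rewrite /P; case: eqP => [->|//]; rewrite /ball /= distrC.
by move=> /(_ ord_max); rewrite /P eqxx /ball /= distrC.
Qed.

(** The last coordinate of the preimage [z] is an integer within 1/2 of [t], hence [t] itself, and
    its parity is an invariant of the class. *)
Lemma end_nbhs_label it j u w : w 0 ord_max = u%:R ->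
  end_nbhs it (sheet K j w) -> it = (j, u).
Proof.
case: it => i t wu [z /= zt /sheetP[-> [s [b [_ e]]]]]; congr pair.
have := e ord_max; rewrite wu sg_last => evenuz.
have [l zl] : exists l : int, z 0 ord_max = l%:~R.
  have [k] := evenuz; case: (b) => /=; rewrite ?expr1 ?expr0 => h.
    by exists (k + k - u%:Z); rewrite !intrD mulrNz -!pmulrn; lra.
  by exists (u%:Z - k - k); rewrite !intrD !mulrNz -!pmulrn; lra.
have zt0 : z 0 ord_max = t%:R.
  have : `|l%:~R - t%:~R : R| < 1.
    by move: zt; rewrite zl -pmulrn => /lt_trans; apply; lra.
  rewrite -intrB -intr_norm ltrz1 ltNge -gtz0_ge1 normr_gt0 negbK subr_eq0.
  by move=> /eqP lt; rewrite zl lt -pmulrn.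
apply/eqP/negPn/negP => tu.
have h : even_int ((u%:R : R) - (-1) ^+ b * t%:R) by rewrite -zt0.
have : (u%:R : R) - (-1) ^+ b * t%:R = 0.
  apply: even_int_small => //.
  move: tu; case: (u); case: (t) => //= _; rewrite ?mulr1 ?mulr0 ?subr0 ?sub0r.
    by rewrite normr1; lra.
  by rewrite normrN normr_sign; lra.
move: tu; case: (u); case: (t) => //= _; rewrite ?mulr1 ?mulr0 ?subr0 ?sub0r.
  by move/eqP; rewrite oner_eq0.
by move/eqP; rewrite oppr_eq0 signr_eq0.
Qed.

(** The sets [end_nbhs] cut the boundary into relatively open pieces, which are therefore also
    relatively closed. *)
Lemma connected_label (C : set tile) i t z j u w : connected C ->
  C `<=` oboundary O -> z 0 ord_max = t%:R -> w 0 ord_max = u%:R ->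
  C (sheet K i z) -> C (sheet K j w) -> (i, t) = (j, u).
Proof.
move=> cC CO zt wu Ci Cj; apply: (@end_nbhs_label _ _ _ _ wu).
have nbhs_self k (v : bool) y : y 0 ord_max = v%:R -> end_nbhs (k, v) (sheet K k y).
  by move=> yv; exists y => //=; rewrite yv subrr normr0 invr_gt0.
suff e : C `&` end_nbhs (i, t) = C by move: Cj; rewrite -e => -[].
apply: cC.
- by exists (sheet K i z); split=> //; exact: nbhs_self.
- by exists (end_nbhs (i, t)) => //; exact: end_nbhs_open.
exists (~` (\bigcup_(a in [set a | a != (i, t)]) end_nbhs a)).
  by apply/open_closedC/bigcup_open => a _; exact: end_nbhs_open.
apply/seteqP; split=> p [Cp]; have /oboundaryP[k [v [y [yv pE]]]] := CO p Cp;
  subst p.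
  move=> /(end_nbhs_label yv) itE;
    split=> // -[a /= ait] /(end_nbhs_label yv) aE.
  by move: ait; rewrite aE itE eqxx.
move=> notU; split=> //; have [<-|kv] := eqVneq (k, v) (i, t);
  first exact: nbhs_self.
by case: notU; exists (k, v) => //; exact: nbhs_self.
Qed.

Lemma end_comp_connected it : connected (end_comp it).
Proof. exact: component_connected. Qed.

Lemma end_comp_label i t j u w : w 0 ord_max = u%:R ->
  end_comp (i, t) (sheet K j w) -> (i, t) = (j, u).
Proof.
move=> wu Cw; apply: (connected_label _ _ (end_pt_last t) wu _ Cw).
- exact: end_comp_connected.
- exact: connected_component_sub.
- by apply: end_comp_sheet; exact: end_pt_last.
Qed.

Lemma end_comp_inj : injective end_comp.
Proof.
move=> [i t] [j u] e; apply: (end_comp_label (end_pt_last u)).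
by rewrite e; apply: end_comp_sheet; exact: end_pt_last.
Qed.

Lemma boundary_componentsE : boundary_components O = range end_comp.
Proof.
apply/seteqP; split=> [_ [p pO <-]|_ [[i t] _ <-]]; last first.
  by exists (sheet K i (end_pt t)) => //; exact: end_pt_boundary.
have /oboundaryP[i [t [z [zt ->]]]] := pO.
by exists (i, t) => //; exact/same_connected_component/end_comp_sheet.
Qed.

(** All sign changes from [K i] fix the image of [end_pt t], the center of a chart; conversely, the
    charts on the sheet [i] have the group [K i]. *)
Lemma end_comp_singular it :
  (end_comp it `&` osingular O !=set0) <-> K it.1 != 1%G.
Proof.
case: it => i t /=; split.
  move=> [p [Cp [[j c] [x [bx xp [g g1 gx]]]]]].
  have /oboundaryP[k [u [w [wu pE]]]] := @connected_component_sub _ _ _ _ Cp.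
  move: Cp; rewrite pE => /(end_comp_label wu) [ik _].
  move: xp; rewrite pE => /sheetP[/= jk _].
  apply: contra g1 => /eqP K1; rewrite -val_eqE /=.
  have : val g \in K i by rewrite ik -jk; exact: (valP g).
  by rewrite K1 => /set1P ->.
move=> K1; have /trivgPn[s sK s1] : K i :!=: 1%g by [].
exists (sheet K i (end_pt t)); split.
  by apply: end_comp_sheet; exact: end_pt_last.
exists (i, (fun l => (l == ord_max) && t)), 0; split.
- by apply/boxP; split=> [j|]; rewrite mxE ?normr0.
- congr (sheet K i _); apply/rowP => l; rewrite !mxE add0r.
  by rewrite /=; case: eqP.
exists (subg (K i) s).
  by apply: contra s1 => /eqP /(congr1 val) /=; rewrite subgK // => ->.
by apply/rowP => l; rewrite !mxE mulr0.
Qed.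

Lemma smooth_boundary_componentsE :
  smooth_boundary_components O = end_comp @` [set it | K it.1 == 1%G].
Proof.
apply/seteqP; split=> [C [+ C0]|_ [it K1 <-]].
  rewrite boundary_componentsE => -[it _ CE]; subst C; exists it => //=.
  by apply/negPn/negP => /end_comp_singular [p]; rewrite C0.
split; first by rewrite boundary_componentsE; exists it.
apply/eqP; apply/negPn/negP => /set0P /end_comp_singular.
by rewrite K1.
Qed.

Lemma singular_boundary_componentsE :
  singular_boundary_components O = end_comp @` [set it | K it.1 != 1%G].
Proof.
apply/seteqP; split=> [C [+ C0]|_ [it K1 <-]].
  rewrite boundary_componentsE => -[it _ CE]; subst C; exists it => //=.
  exact/end_comp_singular.
split; first by rewrite boundary_componentsE; exists it.
exact/end_comp_singular.
Qed.

End BoundaryComponents.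

(** * The two orbifolds *)

(** [None] stands for M, the other two indices for the two copies of G\M. *)
Definition klein_groups1 (i : option bool) : {group klein} :=
  if i is None then 1%G else [set: klein]%G.

Definition klein_gen (i : option bool) : klein :=
  match i with
  | None => (true, false)
  | Some false => (false, true)
  | Some true => (true, true)
  end.

Definition klein_groups2 (i : option bool) : {group klein} := <[klein_gen i]>%G.

Lemma klein_cycleP (x t : klein) : t \in <[x]>%g -> t = 1%g \/ t = x.
Proof.
move=> /cycleP[k ->]; elim: k => [|k [IHk|IHk]]; first by left.
  by right; rewrite expgS IHk mulg1.
by left; rewrite expgS IHk -[X in (x * X)%g]kleinV mulgV.
Qed.

(** * The intertwining matrices *)

Section KleinMatrices.
Context {R : realType}.
Implicit Types (v : option bool -> klein -> R).

(* A function F on M is the sum of its four parts that are even or odd in each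
   of the coordinates 0 and 1.  From (F, F1, F2) on M + 2 G\M, the first matrix
   builds the part of F even in coordinate 0, F1 plus the (odd, even) part of F,
   and F2 plus the (odd, odd) part of F.  The second matrix is its inverse on
   invariant families. *)
Definition klein_mx12 (i : option bool) (q : option bool * klein) : R :=
  match i, q with
  | None, (None, (a, b)) => if b then 0 else 2^-1
  | Some false, (None, (a, b)) => (-1) ^+ a / 4
  | Some true, (None, (a, b)) => (-1) ^+ (a (+) b) / 4
  | Some c, (Some c', t) => ((c == c') && (t == 1%g))%:R
  | None, (Some _, _) => 0
  end.

Definition klein_mx21 (i : option bool) (q : option bool * klein) : R :=
  match i, q with
  | None, (None, t) => (t == 1%g)%:R
  | None, (Some _, (a, b)) => if b then 0 else (-1) ^+ a / 2
  | Some c, (Some c', (a, b)) => if (c == c') && ~~ b then 2^-1 else 0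
  | Some _, (None, _) => 0
  end.

(** With twelve explicit terms, the matrix identities become linear arithmetic after case
    analysis. *)
Lemma klein_actE (A : option bool -> option bool * klein -> R) v i (s : klein) :
  let S k := \sum_(a : bool) \sum_(b : bool)
    A i (k, (a, b)) * v k (s.1 (+) a, s.2 (+) b) in
  klein_act A v i s = S None + (S (Some true) + S (Some false)).
Proof.
rewrite /klein_act (eq_bigr (fun q => A i (q.1, q.2) * v q.1 (s * q.2)%g));
  last first.
  by case.
rewrite -(pair_bigA _ (fun k t => A i (k, t) * v k (s * t)%g)) /=.
rewrite (bigD1 None) //= (bigD1 (Some true)) //= (big_pred1 (Some false)).
  by congr (_ + (_ + _)); rewrite [RHS]pair_bigA; apply: eq_bigr => -[a b] _.
by case=> [[]|].
Qed.

Lemma klein_invariant1 v : klein_invariant klein_groups1 v ->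
  forall c s, v (Some c) s = v (Some c) (false, false).
Proof.
by move=> h c s; rewrite -[RHS](h (Some c) (false, false) s) ?inE // mul1g.
Qed.

Lemma klein_invariant2 v : klein_invariant klein_groups2 v <->
  forall i s, v i (s * klein_gen i)%g = v i s.
Proof.
split=> [h i s|h i s t]; first exact/h/cycle_id.
by move=> /klein_cycleP[] -> //; rewrite mulg1.
Qed.

Lemma klein_mx12_invariant v : klein_invariant klein_groups1 v ->
  klein_invariant klein_groups2 (klein_act klein_mx12 v).
Proof.
move=> /klein_invariant1 h; apply/klein_invariant2 => i [[] []];
  rewrite !klein_actE kleinM /= !big_bool /= !h;
  case: i => [[]|] /=; rewrite ?expr0 ?expr1; lra.
Qed.

(** Each coset gets a fixed representative, so that rewriting with these equations normalizes the
    values. *)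
Lemma klein_invariant2E v : klein_invariant klein_groups2 v ->
  [/\ forall b, v None (true, b) = v None (false, b),
    forall a, v (Some false) (a, true) = v (Some false) (a, false) &
    forall b, v (Some true) (true, b) = v (Some true) (false, ~~ b)].
Proof.
move=> /klein_invariant2 h; split=> a.
- by rewrite -(h None (false, a)) kleinM /= addbF.
- by rewrite -(h (Some false) (a, false)) kleinM /= addbF.
- by rewrite -(h (Some true) (false, ~~ a)) kleinM /= addbT negbK.
Qed.

Lemma klein_mx21_invariant v : klein_invariant klein_groups2 v ->
  klein_invariant klein_groups1 (klein_act klein_mx21 v).
Proof.
move=> /klein_invariant2E[h0 h1 h2] [c|] s t; last by move=> /set1P ->;
  rewrite mulg1.
move=> _; rewrite !klein_actE kleinM !big_bool /= ?h0 ?h1 ?h2.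
by case: c s t => [] [[] []] [[] []] /=; rewrite ?h1 ?h2 /=; lra.
Qed.

(** In the components [Some c], the part coming from M is odd in coordinate 0 and the part coming
    from G\M is even; half sums and half differences over the flip of this coordinate separate
    them. *)
Lemma klein_mx21K v : klein_invariant klein_groups1 v ->
  klein_act klein_mx21 (klein_act klein_mx12 v) = v.
Proof.
move=> /klein_invariant1 h; apply/funext => i; apply/funext => s.
rewrite klein_actE !big_bool /= !klein_actE !big_bool /= !h.
case: i => [c|].
  by rewrite h; case: c s => [] [[] []] /=; rewrite ?expr0 ?expr1; lra.
by case: s => [[] []] /=; rewrite ?expr0 ?expr1; lra.
Qed.

Lemma klein_mx12K v : klein_invariant klein_groups2 v ->
  klein_act klein_mx12 (klein_act klein_mx21 v) = v.
Proof.
move=> /klein_invariant2E[h0 h1 h2]; apply/funext => i; apply/funext => s.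
rewrite klein_actE !big_bool /= !klein_actE !big_bool /=.
by case: i s => [[]|] [[] []] /=; rewrite ?h0 ?h1 ?h2 /= ?expr0 ?expr1; lra.
Qed.

End KleinMatrices.

Lemma klein_groups1_trivial i : (klein_groups1 i == 1%G) = (i == None).
Proof.
case: i => [c|]; last by rewrite !eqxx.
apply/negbTE/eqP => /(congr1 (fun G : {group klein} => ((true, false) : klein) \in G)).
by rewrite !inE.
Qed.

Lemma klein_groups2_nontrivial i : klein_groups2 i != 1%G.
Proof. by rewrite -val_eqE /= cycle_eq1; case: i => [[]|]. Qed.

Theorem proposition6p5 (R : realType) (n : nat) (n_gt2 : (2 < n)%N) :
  exists O1 O2 : riemannian_orbifold R n,
    [/\ compact [set: O1] /\ compact [set: O2],
        components_have_boundary O1 /\ components_have_boundary O2,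
        steklov_isospectral O1 O2,
        ~ (smooth_boundary_components O1 #= smooth_boundary_components O2)%card &
        ~ (singular_boundary_components O1 #=
           singular_boundary_components O2)%card].
Proof.
case: n n_gt2 => [|[|[|m]]] // _.
exists (tile_riemannian klein_groups1), (tile_riemannian klein_groups2); split.
- by split; exact: tile_compact.
- by split; exact: tile_components_have_boundary.
- move=> sigma N; split.
    exact: (transplant_steklov_mult_ge klein_mx12_invariant klein_mx21K).
  exact: (transplant_steklov_mult_ge klein_mx21_invariant klein_mx12K).
- rewrite !smooth_boundary_componentsE.
  rewrite [X in (_ #= _ @` X)%card](_ : _ = set0).
    rewrite image_set0 card_eq0 => /eqP/seteqP[+ _].
    move=> /(_ (end_comp (K := klein_groups1) (None, true))); apply.
    by exists (None, true) => //=; rewrite klein_groups1_trivial.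
  by apply/seteqP; split=> // it /=; apply/negP;
    exact: klein_groups2_nontrivial.
rewrite !singular_boundary_componentsE card_eq_le.
have ecinj (K : option bool -> {group klein}) :
    {in [set it | K it.1 != 1%G] &, injective (end_comp (R := R) (m := m) (K := K))}.
  by move=> ? ? _ _; exact: end_comp_inj.
have e1 := inj_card_eq (ecinj klein_groups1);
  have e2 := inj_card_eq (ecinj klein_groups2).
rewrite (card_le_eql e1) (card_le_eqr e1) (card_le_eql e2) (card_le_eqr e2).
(* [f] injects all six labels into the four singular labels of the first orbifold. An injection of a
   finite type into itself is onto, so [f] reaches [(None, true)], an end of M, where the group is
   trivial. *)
move=> /andP[_ /pcard_leP[f]].
have all2 it : [set it | klein_groups2 it.1 != 1%G] it by exact: klein_groups2_nontrivial.
have finj : injective f by move=> a b /inj; apply; rewrite inE; exact: all2.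
have /codomP[a fa] : (None, true) \in codom f by exact: injF_onto.
have : [set it | klein_groups1 it.1 != 1%G] (f a) by apply: funS; exact: all2.
by rewrite -fa /= eqxx.
Qed.
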